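(* Let $X$ be a real quasireflexive separable Banach space, let $n\ge 1$ and $m\ge 2$ be integers, and let $A_{pj}: X\to X$, $p=1,\dots,m$, $j=1,\dots,n$, be continuous linear operators such that $\operatorname{Ker} A_{pj}=\{0\}$ for all $p,j$. Put $$G_i=\{(A_{1i}x,\dots,A_{mi}x)\in X^m : x\in X\},\quad i=1,\dots,n,$$ and suppose that $$\overline{G_i}\cap\overline{G_j}=\{0\}\quad\text{for all } i,j\in\{1,\dots,n\},\ i\neq j,$$ where the bar denotes closure in $X^m$ in the norm topology. Let $\xi_1,\dots,\xi_n$ be $Q$-independent random variables with values in $X$ whose characteristic functionals do not vanish at any point of $X^*$. Consider the linear forms $L_j=A_{j1}\xi_1+\cdots+A_{jn}\xi_n$, $j=1,\dots,m$. If the distribution of the random vector $\mathbf{L}=(L_1,\dots,L_m)$ belongs to the class $\mathcal{D}_{m,m-1}$, then all $\xi_i$, $i=1,\dots,n$, are Gaussian random variables.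
   Context: $X^*$ is the dual space of $X$, and $\langle x,f\rangle$ is the value of $f\in X^*$ at $x\in X$. Topological notions (continuity, closure) refer to the norm topology. Quasireflexive: a Banach space $X$ is quasireflexive if (the canonical image of) $X$ has finite codimension in its second dual $X^{**}$. Gaussian: a random variable $\xi$ with values in $X$ is called Gaussian if for every $f\in X^*$ the real random variable $\langle \xi,f\rangle$ is Gaussian, i.e. there exist real numbers $m_f$ and $\sigma_f\ge 0$ such that its characteristic function is $e^{\mathrm{i}m_f t-\frac12\sigma_f t^2}$, $t\in\mathbb{R}$ (degenerate distributions are allowed). Characteristic functional: for a random variable $\xi$ with values in $X$ and distribution $\mu_\xi$, $\widehat\mu_{\xi}(f)=\mathbb{E}[e^{\mathrm{i}\langle\xi,f\rangle}]$, $f\in X^*$. Polynomial: a complex-valued function $\psi$ on a vector space $V$ (here $V=(X^* )^n$) is a polynomial if for some $N$ one has $\Delta_h^{N+1}\psi(f)=0$ for all $f,h\in V$, where $\Delta_h\psi(f)=\psi(f+h)-\psi(f)$. $Q$-independence: random variables $\xi_1,\dots,\xi_n$ with values in $X$ (on a common probability space) are $Q$-independent if $$\mathbb{E}\big[e^{\mathrm{i}(\langle\xi_1,f_1\rangle+\cdots+\langle\xi_n,f_n\rangle)}\big]=\Big(\prod_{j=1}^n\widehat\mu_{\xi_j}(f_j)\Big)\exp\{q(f_1,\dots,f_n)\},\quad f_1,\dots,f_n\in X^*,$$ where $q$ is a continuous polynomial on $(X^* )^n$ with $q(0,\dots,0)=0$. Class $\mathcal{D}_{m,k}$, $1\le k\le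 m$: the distribution of a random vector $\boldsymbol{\zeta}=(\zeta_1,\dots,\zeta_m)$ with values in $X^m$ belongs to $\mathcal{D}_{m,k}$ if its characteristic functional admits a factorization $$\mathbb{E}\big[e^{\mathrm{i}(\langle\zeta_1,f_1\rangle+\cdots+\langle\zeta_m,f_m\rangle)}\big]=\prod_{1\le i_1<\dots<i_k\le m}R_{i_1,\dots,i_k}(f_{i_1},\dots,f_{i_k}),\quad f_1,\dots,f_m\in X^*,$$ where the $R_{i_1,\dots,i_k}$ are continuous (complex-valued) functions on $(X^* )^k$ with $R_{i_1,\dots,i_k}(0,\dots,0)=1$. *)

(* Defs.v *)
From HB Require Import structures.
From mathcomp Require Import all_boot all_order all_algebra.
From mathcomp Require Import all_classical all_reals all_analysis.
From mathcomp Require Import complex.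

Set Implicit Arguments.
Unset Strict Implicit.
Unset Printing Implicit Defensive.

Import Order.TTheory GRing.Theory Num.Theory.
Import numFieldNormedType.Exports.

Local Open Scope classical_set_scope.
Local Open Scope ring_scope.
Local Open Scope complex_scope.

(* The library puts no topology on R[i]: it gets that of the complex modulus. *)
HB.instance Definition _ (R : rcfType) :=
  NormedModule.copy R[i] (R[i] : numFieldType)^o.

Definition continuous_functional (R : realType) (V : normedModType R) :
    {pred (V -> R^o)} :=
  fun f => `[< linear f /\ continuous f >].

Section Dual.
Context {R : realType} (V : normedModType R).

Lemma continuous_functional_submod_closed :
  submod_closed (@continuous_functional R V).
Proof.
split.
  apply/asboolP; split; first by move=> a x y; rewrite scaler0 addr0.
  exact: cst_continuous.
move=> a f g /asboolP[lf cf] /asboolP[lg cg]; apply/asboolP; split.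
  move=> b x y /=; rewrite !fctE lf lg.
  by rewrite !scalerDr addrACA !scalerA (mulrC a b).
move=> x; apply: cvgD; last exact: cg.
by apply: cvgZl_tmp; exact: cf.
Qed.

HB.instance Definition _ := GRing.isSubmodClosed.Build R (V -> R^o)
  (@continuous_functional R V) continuous_functional_submod_closed.

Record dual : Type := Dual {
  dual_fun :> V -> R^o ;
  dual_funP : continuous_functional dual_fun }.

HB.instance Definition _ := [isSub for dual_fun].
HB.instance Definition _ := [Choice of dual by <:].
HB.instance Definition _ := [SubChoice_isSubLmodule of dual by <:].

Lemma dual_continuous (f : dual) : continuous f.
Proof. by have /asboolP[] := dual_funP f. Qed.

Lemma dual_linear (f : dual) : linear f.
Proof. by have /asboolP[] := dual_funP f. Qed.

HB.instance Definition _ (f : dual) :=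
  GRing.isLinear.Build R V R^o *:%R f (dual_linear f).

Definition opnorm (f : dual) : R := sup [set `|f x| | x in [set x | `|x| <= 1]].

Lemma has_sup_opnorm (f : dual) :
  has_sup [set `|f x| | x in [set x | `|x| <= 1]].
Proof.
split; first by exists `|f 0|, 0 => //=; rewrite normr0.
have /linear_bounded_continuous/linear_boundedP := @dual_continuous f.
move=> /pinfty_ex_gt0[M M0 fM]; exists M => _ [x /= x1 <-].
by rewrite (le_trans (fM x))// ler_piMr// ltW.
Qed.

Lemma opnorm_ge0 (f : dual) : 0 <= opnorm f.
Proof.
apply: (@le_trans _ _ `|f 0|) => //.
by apply: sup_upper_bound; [exact: has_sup_opnorm|exists 0 => //=; rewrite normr0].
Qed.

Lemma ler_opnorm (f : dual) (x : V) : `|f x| <= opnorm f * `|x|.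
Proof.
have [->|x0] := eqVneq x 0; first by rewrite linear0 !normr0 mulr0.
have nx : 0 < `|x| by rewrite normr_gt0.
have : `|f (`|x|^-1 *: x)| <= opnorm f.
  apply: sup_upper_bound; first exact: has_sup_opnorm.
  exists (`|x|^-1 *: x) => //=.
  by rewrite normrZ normfV normr_id mulVf ?normr_eq0.
by rewrite linearZ normrZ normfV normr_id mulrC ler_pdivrMr.
Qed.

Lemma opnorm_le (f : dual) (M : R) : 0 <= M ->
  (forall x, `|f x| <= M * `|x|) -> opnorm f <= M.
Proof.
move=> M0 fM; apply: ge_sup; first by case: (has_sup_opnorm f).
by move=> _ [x /= x1 <-]; rewrite (le_trans (fM x))// ler_piMr.
Qed.

Lemma opnormD (f g : dual) : opnorm (f + g) <= opnorm f + opnorm g.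
Proof.
apply: opnorm_le; first by rewrite addr_ge0// opnorm_ge0.
move=> x; rewrite mulrDl (le_trans (ler_normD _ _))// lerD//; exact: ler_opnorm.
Qed.

Lemma opnormZ (a : R) (f : dual) : opnorm (a *: f) = `|a| * opnorm f.
Proof.
have le b (g : dual) : opnorm (b *: g) <= `|b| * opnorm g.
  apply: opnorm_le; first by rewrite mulr_ge0// opnorm_ge0.
  by move=> x; rewrite [X in `|X|]/= normrM -mulrA ler_wpM2l// ler_opnorm.
apply/eqP; rewrite eq_le le/=.
have [->|a0] := eqVneq a 0; first by rewrite normr0 mul0r opnorm_ge0.
rewrite -ler_pdivlMl ?normr_gt0// -normfV.
by rewrite -{1}[f]scale1r -(mulVf a0) -scalerA le.
Qed.

Lemma opnorm0_eq0 (f : dual) : opnorm f = 0 -> f = 0.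
Proof.
move=> f0; apply/val_inj/funext => x /=.
by apply/eqP; rewrite -normr_le0 (le_trans (ler_opnorm _ _))// f0 mul0r.
Qed.

HB.instance Definition _ := Lmodule_isNormed.Build R dual
  opnormD opnormZ opnorm0_eq0.

End Dual.
Section Bidual.
Context {R : realType} (V : normedModType R).

Lemma eval_continuous_functional (x : V) :
  continuous_functional (fun f : dual V => f x : R^o).
Proof.
have lin : linear (fun f : dual V => f x : R^o) by [].
apply/asboolP; split=> //.
pose L := GRing.isLinear.Build R (dual V) R^o *:%R _ lin.
pose e : {linear dual V -> R^o} := HB.pack (fun f : dual V => f x : R^o) L.
apply: (@bounded_linear_continuous _ _ _ e); apply/linear_boundedP.
near=> r => f; rewrite (le_trans (ler_opnorm f x))// mulrC ler_wpM2r//.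
exact: opnorm_ge0.
Unshelve. all: by end_near. Qed.

Definition canonical_embedding (x : V) : dual (dual V) :=
  Dual (eval_continuous_functional x).

(* Finite codimension of the image of V: finitely many classes span V** / V. *)
Definition quasireflexive : Prop :=
  exists (N : nat) (e : 'I_N -> dual (dual V)),
    forall F : dual (dual V), exists (x : V) (c : 'I_N -> R),
      F = canonical_embedding x + \sum_(i < N) c i *: e i.

End Bidual.

Definition separable (T : topologicalType) : Prop :=
  exists2 A : set T, countable A & dense A.

Definition borel (T : ptopologicalType) := g_sigma_algebraType (@open T).

Section CharacteristicFunctionals.
Context {R : realType} {d : measure_display} {Omega : measurableType d}.
Variable P : probability Omega R.

Definition cexp (z : R[i]) : R[i] :=
  (expR (complex.Re z))%:C * (cos (complex.Im z) +i* sin (complex.Im z)).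

Definition cexpectation (Z : Omega -> R[i]) : R[i] :=
  fine 'E_P[fun w => complex.Re (Z w)] +i* fine 'E_P[fun w => complex.Im (Z w)].

Context {X : normedModType R}.

Definition charfunctional (xi : Omega -> X) (f : dual X) : R[i] :=
  cexpectation (fun w => cexp (0 +i* f (xi w))).

Definition joint_charfunctional (m : nat) (zeta : 'I_m -> Omega -> X)
    (f : 'I_m -> dual X) : R[i] :=
  cexpectation (fun w => cexp (0 +i* \sum_(j < m) f j (zeta j w))).

Definition gaussian (xi : Omega -> X) : Prop :=
  forall f : dual X, exists mean sigma : R, 0 <= sigma /\
    forall t : R, cexpectation (fun w => cexp (0 +i* (t * f (xi w)))) =
                  cexp ((- (sigma * t ^+ 2 / 2)) +i* (mean * t)).

Definition forward_difference (V : zmodType) (h : V) (psi : V -> R[i]) :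
    V -> R[i] :=
  fun f => psi (f + h) - psi f.

Definition is_polynomial (V : zmodType) (psi : V -> R[i]) : Prop :=
  exists N : nat, forall f h : V, iter N.+1 (forward_difference h) psi f = 0.

(* On a finite power, the product topology [{ptws 'I_n -> _}] is the norm
   topology. *)
Definition Q_independent (n : nat) (xi : 'I_n -> Omega -> X) : Prop :=
  exists q : ('I_n -> dual X) -> R[i],
    [/\ is_polynomial q,
        continuous (q : {ptws 'I_n -> dual X} -> R[i]),
        q (fun=> 0) = 0 &
        forall f : 'I_n -> dual X,
          joint_charfunctional xi f =
          (\prod_(j < n) charfunctional (xi j) (f j)) * cexp (q f)].

Definition increasing_tuple (m k : nat) (s : k.-tuple 'I_m) : bool :=
  sorted (fun i j : 'I_m => (i < j)%N) s.

Definition in_class_D (m k : nat) (zeta : 'I_m -> Omega -> X) : Prop :=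
  exists F : k.-tuple 'I_m -> ('I_k -> dual X) -> R[i],
    (forall s, increasing_tuple s ->
       continuous (F s : {ptws 'I_k -> dual X} -> R[i]) /\
       F s (fun=> 0) = 1) /\
    forall f : 'I_m -> dual X,
      joint_charfunctional zeta f =
      \prod_(s : k.-tuple 'I_m | increasing_tuple s) F s (fun j => f (tnth s j)).

End CharacteristicFunctionals.

Section LinearForms.
Context {R : realType} {X : normedModType R} {m n : nat}.
Variable A : 'I_m -> 'I_n -> X -> X.

Definition operator_graph (i : 'I_n) : set {ptws 'I_m -> X} :=
  range (fun x p => A p i x).

Definition linear_forms (Omega : Type) (xi : 'I_n -> Omega -> X) :
    'I_m -> Omega -> X :=
  fun j w => \sum_(i < n) A j i (xi i w).

End LinearForms.

(* Main.v *)
Require Import Defs.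
From HB Require Import structures.
From mathcomp Require Import all_boot all_order all_algebra.
From mathcomp Require Import all_classical all_reals all_analysis.
From mathcomp Require Import complex.
From mathcomp Require Import measurable_realfun.
From mathcomp Require Import ring lra.

(** The proof turns the factorization of the characteristic functional of the
    linear forms into a difference equation for each characteristic functional
    u_i of xi_i, and then shows that its solutions are Gaussian.

    On the tuples kappa of functionals, the hypotheses give
      prod_j u_j (a_j kappa) * exp (q (a kappa)) = prod_s F_s (kappa o s),
    where a_j kappa = sum_p A_pj^* kappa_p.  Take quotient differences
    u(f + h) / u(f) of both sides along three kinds of steps: steps supported in
    one coordinate p, which leave unchanged the factors F_s that miss p; steps
    with a_j kappa = 0, which leave the factor u_j unchanged; and a repeated
    step, which turns the polynomial q into 0.  Only u_i survives
    ([isolated_factor]): its differences are trivial for steps taken from the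
    images under a_i of these subspaces of steps.

    Each of these images is total in X*: for a vector x that it annihilates, A_pi x is 0
    for some p, or (A_1i x, ..., A_mi x) is in the closures of G_i and of G_j at once
    ([total_coordinate_steps], [total_annihilating_steps]).  The images need not be norm
    dense, and this is where quasireflexivity enters: a total subspace of the dual of
    a separable quasireflexive space reaches every functional by finitely many
    passages to weak* limits of sequences ([total_subspace_wstar_dense]).  A
    characteristic functional is weak* sequentially continuous by dominated
    convergence, so the difference equation holds for all steps
    ([mdiff_extend]).

    On a ray, t |-> u_i (t f) is then a continuous function whose quotient
    differences of some order are trivial, hence the exponential of a polynomial p
    ([polynomial_logarithm]).  That p is quadratic is the theorem of Marcinkiewicz
    ([marcinkiewicz]).  It rests on the ridge inequality
    Re p(x + iy) <= Re p(iy) ([ridge]), which says that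
    |E exp((ix - y) eta)| <= E exp(- y eta) for the random variable eta, but is
    derived without any integrability of eta: exp(y eta) is replaced by
    trigonometric polynomials that are nonnegative, and the limit is taken in the
    derivatives of exp o p.  If the degree n of p exceeded 2, there would be a
    complex z off the imaginary axis such that z^n is a positive multiple of the
    conjugate of the leading coefficient, and the inequality would fail along the
    ray of z ([ridge_size]). *)

Set Implicit Arguments.
Unset Strict Implicit.
Unset Printing Implicit Defensive.

Import Order.TTheory GRing.Theory Num.Theory.
Import numFieldNormedType.Exports.

Local Open Scope classical_set_scope.
Local Open Scope ring_scope.

Local Open Scope complex_scope.
Local Notation Re := complex.Re.
Local Notation Im := complex.Im.

(** * The Hahn-Banach theorem *)

Section HahnBanach.
Context {R : realType} {V : lmodType R} (p : V -> R).
Hypothesis pD : forall x y, p (x + y) <= p x + p y.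
Hypothesis pZ : forall a x, p (a *: x) = `|a| * p x.

(** Partial linear functionals are encoded by their graphs: the union of a chain of
    graphs is again one, and the bound by p makes the relation functional. *)
Definition dominated_linear_relation (G : set (V * R)) : Prop :=
  (forall a u v, G u -> G v -> G (a *: u.1 + v.1, a * u.2 + v.2)) /\
  (forall u, G u -> u.2 <= p u.1).

(** The value r at v has to satisfy s - p (w - v) <= r <= p (w' + v) - s' for all
    (w, s) and (w', s') in the graph, and these two families of bounds are compatible
    by subadditivity. *)
Lemma one_dimensional_extension (G : set (V * R)) (v : V) :
  G !=set0 -> dominated_linear_relation G -> exists r : R,
  dominated_linear_relation
    [set u | exists w t, G w /\ u = (w.1 + t *: v, w.2 + t * r)].
Proof.
move=> G0 [GL Gp].
pose S := [set w.2 - p (w.1 - v) | w in G].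
have key w w' : G w -> G w' -> w.2 - p (w.1 - v) <= p (w'.1 + v) - w'.2.
  move=> Gw Gw'.
  have := Gp _ (GL 1 _ _ Gw Gw'); rewrite /= scale1r mul1r => h.
  have := pD (w.1 - v) (w'.1 + v); rewrite addrACA addNr addr0 => h'.
  by lra.
have supS : has_sup S.
  case: G0 => w Gw; split; first by exists (w.2 - p (w.1 - v)), w.
  by exists (p (w.1 + v) - w.2) => _ [w' Gw' <-]; exact: key.
have GZ a w : G w -> G (a *: w.1, a * w.2).
  move=> Gw; have := GL (a - 1) _ _ Gw Gw.
  by rewrite scalerBl mulrBl scale1r mul1r !subrK.
exists (sup S); split.
  move=> a _ _ [w [t [Gw ->]]] [w' [t' [Gw' ->]]].
  exists (a *: w.1 + w'.1, a * w.2 + w'.2), (a * t + t'); split; first exact: GL.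
  congr (_, _) => /=; last by ring.
  by rewrite scalerDr scalerDl scalerA addrACA.
move=> _ [w [t [Gw ->]]] /=.
have [->|t0] := eqVneq t 0; first by rewrite scale0r addr0 mul0r addr0; exact: Gp.
have Gs := GZ `|t|^-1 _ Gw.
have nt : 0 < `|t| by rewrite normr_gt0.
have pE s : p (w.1 + s *: (`|t| *: v)) = `|t| * p (`|t|^-1 *: w.1 + s *: v).
  rewrite -[in X in _ = X * _](normr_id t) -pZ scalerDr !scalerA mulfV ?gt_eqF//.
  by rewrite scale1r (mulrC s).
have wE : w.2 = `|t| * (`|t|^-1 * w.2) by rewrite mulrA mulfV ?gt_eqF// mul1r.
have [t1|t1] := ltP 0 t.
  have le : sup S <= p (`|t|^-1 *: w.1 + v) - `|t|^-1 * w.2.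
    by apply: ge_sup; [case: supS|move=> _ [w' Gw' <-]; exact: (key _ _ Gw' Gs)].
  have := pE 1; rewrite !scale1r gtr0_norm// => ->.
  by rewrite wE gtr0_norm// -mulrDr ler_pM2l//; rewrite gtr0_norm// in le; lra.
have le : `|t|^-1 * w.2 - p (`|t|^-1 *: w.1 - v) <= sup S.
  by apply: sup_upper_bound => //; exists (`|t|^-1 *: w.1, `|t|^-1 * w.2).
have tE : t = - `|t| by rewrite ler0_norm// opprK.
have := pE (-1); rewrite !scaleN1r -scaleNr -tE => ->.
have -> : t * sup S = - (`|t| * sup S) by rewrite -mulNr -tE.
rewrite wE -mulrBr ler_pM2l//.
by lra.
Qed.

Lemma hahn_banach (G0 : set (V * R)) :
  G0 !=set0 -> dominated_linear_relation G0 ->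
  exists F : V -> R^o, [/\ linear F, forall u, G0 u -> F u.1 = u.2 &
    forall v, `|F v| <= p v].
Proof.
move=> G00 G0d.
pose P : set (set (V * R)) := fun A => dominated_linear_relation (A `|` G0).
have [F FP Ftot|A [PA maxA]] := @Zorn_bigcup (V * R)%type P.
  have common u v : ((\bigcup_(X in F) X) `|` G0) u ->
      ((\bigcup_(X in F) X) `|` G0) v ->
      (G0 u /\ G0 v) \/ exists2 X, F X & (X `|` G0) u /\ (X `|` G0) v.
    move=> [[X FX Xu]|Gu] [[Y FY Yv]|Gv].
    - by have [s|s] := Ftot _ _ FX FY; right; [exists Y|exists X] => //;
         split; left=> //; exact: s.
    - by right; exists X => //; split; [left|right].
    - by right; exists Y => //; split; [right|left].
    - by left.
  split.
    move=> a u v Fu Fv; have [[Gu Gv]|[X FX [Xu Xv]]] := common _ _ Fu Fv.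
      by right; exact: G0d.1.
    have [XL _] := FP _ FX.
    by have [Xs|Gs] := XL a u v Xu Xv; [left; exists X|right].
  move=> u Fu; have [[Gu _]|[X FX [Xu _]]] := common _ _ Fu Fu.
    exact: G0d.2.
  by have [_ Xp] := FP _ FX; exact: Xp.
set G := A `|` G0 in PA.
have GN0 : G !=set0 by case: G00 => u G0u; exists u; right.
have dom v : exists r, G (v, r).
  have [r Gr] := one_dimensional_extension v GN0 PA.
  set G' := [set _ | _] in Gr.
  have GG' : G `<=` G'.
    by move=> u Gu; exists u, 0; split=> //; rewrite scale0r mul0r !addr0 -surjective_pairing.
  have PG' : P G'.
    rewrite /P (_ : G' `|` G0 = G')//; apply/setUidPl => u G0u.
    by apply: GG'; right.
  have AG' : A `<=` G' by move=> u Au; apply: GG'; left.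
  have G'A : G' `<=` A.
    by apply: contrapT => nG'A; exact: (maxA G' (conj AG' nG'A)).
  have Gz : G (0, 0).
    case: GN0 => u Gu; have := PA.1 (-1) _ _ Gu Gu.
    by rewrite scaleN1r mulN1r !addNr.
  exists r; left; apply: G'A; exists (0, 0), 1; split=> //=.
  by rewrite scale1r mul1r !add0r.
have [GL Gp] := PA.
have G0r r : G (0, r) -> r = 0.
  move=> Gr.
  have p0 : p 0 = 0 by have := pZ 0 0; rewrite scale0r normr0 mul0r.
  have := Gp _ Gr; have := GL (-2) _ _ Gr Gr => /= Gr'; have := Gp _ Gr'.
  by rewrite /= scaler0 addr0 p0; lra.
have Guniq v r s : G (v, r) -> G (v, s) -> r = s.
  move=> Gr Gs; apply/esym/eqP; rewrite -subr_eq0; apply/eqP/G0r.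
  by have := GL (-1) _ _ Gr Gs; rewrite /= scaleN1r addNr mulN1r addrC.
have [F FG] := choice dom.
have Flin : linear (F : V -> R^o).
  by move=> a u v; apply: (Guniq _ _ _ (FG _)); exact: (GL a _ _ (FG u) (FG v)).
exists F; split=> //.
- by move=> u G0u; apply: (Guniq u.1) => //; right; rewrite -surjective_pairing.
- move=> v; rewrite ler_norml (Gp _ (FG v)) andbT.
  have := Gp _ (GL (-1) _ _ (FG v) (FG 0)); rewrite /= addr0.
  rewrite (G0r _ (FG 0)) pZ normrN1 mul1r addr0 mulN1r; lra.
Qed.

(** The functional t v + s |-> e t is dominated by p, because v stays at distance e
    from S; its extension is then rescaled by 1 / e. *)
Lemma hahn_banach_separation (S : set V) (v : V) (e : R) :
  S 0 -> (forall a x y, S x -> S y -> S (a *: x + y)) -> 0 < e ->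
  (forall s, S s -> e <= p (v - s)) ->
  exists F : V -> R^o, [/\ linear F, forall s, S s -> F s = 0, F v = 1 &
    forall x, `|F x| <= e^-1 * p x].
Proof.
move=> S0 SL e0 dist.
pose G := [set u : V * R | exists s t, S s /\ u = (t *: v + s, e * t)].
have Gd : dominated_linear_relation G.
  split.
    move=> a _ _ [s [t [Ss ->]]] [s' [t' [Ss' ->]]] /=.
    exists (a *: s + s'), (a * t + t'); split; first exact: SL.
    congr (_, _) => /=; last by ring.
    by rewrite scalerDr scalerDl scalerA addrACA.
  move=> _ [s [t [Ss ->]]] /=.
  have p0 : p 0 = 0 by have := pZ 0 0; rewrite scale0r normr0 mul0r.
  have pN x : p (- x) = p x by rewrite -scaleN1r pZ normrN1 mul1r.
  have pge0 x : 0 <= p x by have := pD x (- x); rewrite subrr p0 pN; lra.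
  have [->|t0] := eqVneq t 0; first by rewrite mulr0 pge0.
  have -> : t *: v + s = t *: (v - (- t^-1) *: s).
    by rewrite scalerBr scalerA mulrN mulfV// scaleN1r opprK.
  rewrite pZ (le_trans (y := `|t| * e))//.
    by rewrite (mulrC e) ler_wpM2r ?ler_norm// ltW.
  rewrite ler_wpM2l//; apply: dist.
  by have := SL (- t^-1) _ _ Ss S0; rewrite addr0.
have [F [Flin FG Fp]] : exists F : V -> R^o,
    [/\ linear F, forall u, G u -> F u.1 = u.2 & forall v, `|F v| <= p v].
  by apply: hahn_banach => //; exists (0, 0), 0, 0; split=> //; rewrite scale0r addr0 mulr0.
exists (fun x => e^-1 *: F x); split.
- move=> a x y /=; rewrite Flin scalerDr; congr (_ + _).
  by rewrite !scalerA mulrC.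
- move=> s Ss; rewrite (FG (s, 0)) /= ?scaler0//; exists s, 0; split=> //.
  by rewrite scale0r add0r mulr0.
- rewrite (FG (v, e)) /=; first by rewrite /GRing.scale /= mulVf ?gt_eqF.
  by exists 0, 1; split=> //; rewrite scale1r addr0 mulr1.
- move=> x; rewrite /GRing.scale /= normrM gtr0_norm ?invr_gt0//.
  by rewrite ler_wpM2l// invr_ge0 ltW.
Qed.

End HahnBanach.

(** * Dual spaces and subspaces of finite codimension *)

Section DualSpace.
Context {R : realType}.

Lemma dual_of_bounded (V : normedModType R) (F : V -> R^o) (C : R) :
  linear F -> (forall x, `|F x| <= C * `|x|) ->
  exists f : dual V, forall x, f x = F x.
Proof.
move=> Flin FC.
pose L := GRing.isLinear.Build R V R^o *:%R _ Flin.
pose e : {linear V -> R^o} := HB.pack F L.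
have cF : continuous F.
  apply: (@bounded_linear_continuous _ _ _ e); apply/linear_boundedP.
  near=> r => x; rewrite (le_trans (FC x))// ler_wpM2r//.
suff FP : continuous_functional F by exists (Dual FP).
by apply/asboolP.
Unshelve. all: by end_near. Qed.

Lemma dual_normE (V : normedModType R) (f : dual V) (C : R) : 0 <= C ->
  (forall x, `|f x| <= C * `|x|) -> `|f| <= C.
Proof. exact: opnorm_le. Qed.

Lemma dual_ler (V : normedModType R) (f : dual V) (x : V) :
  `|f x| <= `|f| * `|x|.
Proof. exact: ler_opnorm. Qed.

Lemma dualD (V : normedModType R) (f g : dual V) x : (f + g) x = f x + g x.
Proof. by []. Qed.
Lemma dualZ (V : normedModType R) a (f : dual V) x : (a *: f) x = a * f x.
Proof. by []. Qed.
Lemma dual0 (V : normedModType R) x : (0 : dual V) x = 0.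
Proof. by []. Qed.
Lemma dualB (V : normedModType R) (f g : dual V) x : (f - g) x = f x - g x.
Proof. by []. Qed.

Lemma dual_ext (V : normedModType R) (f g : dual V) : (forall x, f x = g x) -> f = g.
Proof. by move=> fg; apply/val_inj/funext. Qed.

Definition subspace (V : lmodType R) (S : set V) : Prop :=
  S 0 /\ forall a x y, S x -> S y -> S (a *: x + y).

Definition approximable (V : normedModType R) (S : set V) (v : V) : Prop :=
  forall e, 0 < e -> exists2 s, S s & `|v - s| < e.

Lemma dual_separation (V : normedModType R) (S : set V) (v : V) (e : R) :
  subspace S -> 0 < e -> (forall s, S s -> e <= `|v - s|) ->
  exists f : dual V, [/\ forall s, S s -> f s = 0, f v = 1 & `|f| <= e^-1].
Proof.
move=> [S0 SL] e0 dist.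
have [F [Flin FS Fv Fe]] := hahn_banach_separation (@ler_normD _ V)
  (@normrZ _ V) S0 SL e0 dist.
have [f fE] := dual_of_bounded Flin Fe.
exists f; split; [by move=> s /FS <-|by rewrite fE|].
by apply: dual_normE => [|x]; rewrite ?fE// invr_ge0 ltW.
Qed.

Lemma not_approximable (V : normedModType R) (S : set V) (v : V) :
  ~ approximable S v -> exists2 e, 0 < e & forall s, S s -> e <= `|v - s|.
Proof.
move=> /existsNP[e /not_implyP[e0 h]]; exists e => // s Ss.
by rewrite leNgt; apply/negP => lt; apply: h; exists s.
Qed.

Lemma dual_separates (V : normedModType R) (x : V) :
  (forall f : dual V, f x = 0) -> x = 0.
Proof.
move=> fx; apply: contrapT => /eqP x0.
have [|||f [_ f1 _]] := @dual_separation V [set 0] x `|x|.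
- by split=> //= a y z -> ->; rewrite scaler0 addr0.
- by rewrite normr_gt0.
- by move=> s /= ->; rewrite subr0.
by have /eqP := fx f; rewrite f1 oner_eq0.
Qed.

Lemma norm_canonical_embedding (V : normedModType R) (x : V) :
  `|x| <= `|canonical_embedding x|.
Proof.
have [->|x0] := eqVneq x 0; first by rewrite normr0.
have nx : 0 < `|x| by rewrite normr_gt0.
have [|||f [_ f1 fx]] := @dual_separation V [set 0] x `|x|.
- by split=> //= a y z -> ->; rewrite scaler0 addr0.
- by [].
- by move=> s /= ->; rewrite subr0.
have := dual_ler (canonical_embedding x) f; rewrite /= f1 normr1 => h.
rewrite -[leLHS]mulr1 -ler_pdivlMl// mulrC.
by rewrite (le_trans h)// ler_wpM2l.
Qed.

(** The embedding is isometric and the space is complete, so a sequence of vectors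
    whose images approach F converges. *)
Lemma approximable_canonical_embedding (V : completeNormedModType R)
    (F : dual (dual V)) :
  approximable (range (@canonical_embedding R V)) F ->
  range (@canonical_embedding R V) F.
Proof.
move=> apF.
have /choice[x xP] n : exists x : V, `|F - canonical_embedding x| < n.+1%:R^-1.
  by have [|_ [x _ <-] lt] := apF n.+1%:R^-1; [rewrite invr_gt0|exists x].
have dx m n : `|x m - x n| <= m.+1%:R^-1 + n.+1%:R^-1.
  rewrite (le_trans (norm_canonical_embedding _))//.
  have -> : canonical_embedding (x m - x n) =
      (F - canonical_embedding (x n)) - (F - canonical_embedding (x m)).
    apply: dual_ext => f; rewrite !dualB /= linearB /=; ring.
  by rewrite (le_trans (ler_normB _ _))// addrC lerD// ltW.
have cx : cvg (x @ \oo).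
  apply/cauchy_cvgP; apply: cauchy_exP => e e0.
  have e2 : 0 < e / 2 by rewrite divr_gt0.
  near \oo => m; exists (x m).
  change (\forall n \near \oo, ball (x m) e (x n)); near=> n.
  rewrite -ball_normE /ball_ /= (le_lt_trans (dx m n))// [ltRHS]splitr ltrD//.
    by near: m; exact: near_infty_natSinv_lt (PosNum e2).
  by near: n; exact: near_infty_natSinv_lt (PosNum e2).
exists (lim (x @ \oo)) => //; set l := lim _.
apply/esym/dual_ext => f /=.
have h1 : (fun n => f (x n)) @ \oo --> f l.
  by apply: continuous_cvg => //; exact: dual_continuous.
have h2 : (fun n => f (x n)) @ \oo --> F f.
  apply/cvgrPdist_lt => e e0; near=> n.
  have := dual_ler (F - canonical_embedding (x n)) f; rewrite dualB /= => h.
  rewrite (le_lt_trans h)//.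
  rewrite (@le_lt_trans _ _ (n.+1%:R^-1 * (`|f| + 1)))//.
    by rewrite ler_pM// ?ltW// ltrDl.
  rewrite -ltr_pdivlMr; last by rewrite ltr_wpDl.
  near: n; have h' : 0 < e / (`|f| + 1) by rewrite divr_gt0// ltr_wpDl.
  exact: near_infty_natSinv_lt (PosNum h').
by apply: (cvg_unique _ h2 h1).
Unshelve. all: by end_near. Qed.

(** Y + span L, in the form that suits inductions over L in which the vectors of L
    are split off one at a time. *)
Fixpoint plus_span (V : lmodType R) (Y : set V) (L : seq V) : set V :=
  if L is v :: L' then [set w | exists c, plus_span Y L' (w - c *: v)] else Y.

Lemma plus_span_subspace (V : lmodType R) (Y : set V) (L : seq V) :
  subspace Y -> subspace (plus_span Y L).
Proof.
move=> Ysub; elim: L => // v L [L0 LL]; split.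
  by exists 0; rewrite scale0r subr0.
move=> a x y [c xc] [d yd]; exists (a * c + d).
have -> : a *: x + y - (a * c + d) *: v = a *: (x - c *: v) + (y - d *: v).
  by rewrite scalerBr scalerDl scalerA opprD addrACA.
exact: LL.
Qed.

Lemma sub_plus_span (V : lmodType R) (Y : set V) (L : seq V) :
  Y `<=` plus_span Y L.
Proof.
elim: L => // v L IH y /IH Ly.
by exists 0; rewrite scale0r subr0.
Qed.

Lemma plus_spanS (V : lmodType R) (Y Y' : set V) (L : seq V) :
  Y `<=` Y' -> plus_span Y L `<=` plus_span Y' L.
Proof.
by move=> YY'; elim: L => //= v L IH w [c /IH h]; exists c.
Qed.

Lemma plus_span_split (V : lmodType R) (Y : set V) (L : seq V) w :
  plus_span Y L w -> exists2 y, Y y & plus_span [set 0] L (w - y).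
Proof.
elim: L w => [w Yw|v L IH w [c /IH[y Yy h]]]; first by exists w => //=; rewrite subrr.
by exists y => //; exists c; rewrite addrAC.
Qed.

(** A closed subspace stays closed when a vector v is added: if v is not already in
    it, a functional that vanishes on the subspace and is 1 at v reads off the
    coefficient of v, which therefore converges along approximations. *)
Lemma approximable_plus_span (V : normedModType R) (Y : set V) (L : seq V) :
  subspace Y -> (forall w, approximable Y w -> Y w) ->
  forall w, approximable (plus_span Y L) w -> plus_span Y L w.
Proof.
move=> Ysub Ycl; elim: L => [|v L IH] w apw; first exact: Ycl.
have Lsub := plus_span_subspace L Ysub.
have [apv|/not_approximable[e e0 dist]] := pselect (approximable (plus_span Y L) v).
  have Lv := IH _ apv.
  exists 0; rewrite scale0r subr0; apply: IH => e e0.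
  have [s [c Ls] lt] := apw _ e0; exists s => //.
  have := Lsub.2 c _ _ Lv Ls.
  by rewrite addrC subrK.
have [phi [phi0 phi1 _]] := dual_separation Lsub e0 dist.
exists (phi w); apply: IH => d d0.
have C0 : 0 < 1 + `|phi| * `|v| by rewrite ltr_pwDl// mulr_ge0.
have [s [c Ls] lt] := apw _ (divr_gt0 d0 C0).
exists (s - c *: v) => //.
have phis : phi s = c.
  have := phi0 _ Ls; rewrite linearB linearZ /= phi1 => /eqP.
  by rewrite subr_eq0 => /eqP ->; rewrite /GRing.scale /= mulr1.
have -> : w - phi w *: v - (s - c *: v) = (w - s) - phi (w - s) *: v.
  have -> : phi (w - s) = phi w - c by rewrite linearB /= phis.
  by rewrite scalerBl !opprB -!addrA; congr (_ + _);
    rewrite [RHS]addrC -[RHS]addrA [RHS]addrCA.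
rewrite (le_lt_trans (ler_normB _ _))// normrZ.
rewrite (@le_lt_trans _ _ (`|w - s| * (1 + `|phi| * `|v|)))//; last first.
  by rewrite -ltr_pdivlMr.
rewrite mulrDr mulr1 lerD2l mulrA (mulrC `|w - s|) ler_wpM2r//.
exact: dual_ler.
Qed.

Definition joint_kernel (V : normedModType R) (L : seq (dual V)) : set V :=
  [set e | forall f, f \in L -> f e = 0].

Lemma joint_kernel_subspace (V : normedModType R) (L : seq (dual V)) :
  subspace (joint_kernel L).
Proof.
split=> [f _|a x y Lx Ly f fL]; first by rewrite linear0.
by rewrite linearP /= Lx// Ly// scaler0 addr0.
Qed.

Lemma joint_kernel_cons (V : normedModType R) (L : seq (dual V)) f v :
  joint_kernel (f :: L) v <-> f v = 0 /\ joint_kernel L v.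
Proof.
split=> [h|[fv h] g].
  split; first by apply: h; rewrite mem_head.
  by move=> g gL; apply: h; rewrite in_cons gL orbT.
by rewrite in_cons => /orP[/eqP ->//|/h].
Qed.

Lemma span_joint_kernel (V : normedModType R) (L : seq (dual V)) (g : dual V) :
  plus_span [set 0] L g -> forall v, joint_kernel L v -> g v = 0.
Proof.
elim: L g => [g /= -> //|f L IH g [c /IH h] v /joint_kernel_cons[fv /h]].
by rewrite dualB dualZ fv mulr0 subr0.
Qed.

(** Induction on the number of functionals: if f does not vanish on the kernel of
    the others, a vector u of that kernel with f u <> 0 allows to subtract from g the
    multiple of f that makes it vanish there. *)
Lemma joint_kernel_span (V : normedModType R) (L : seq (dual V)) (g : dual V) :
  (forall v, joint_kernel L v -> g v = 0) -> plus_span [set 0] L g.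
Proof.
elim: L g => [g h|f L IH g h].
  by apply: dual_ext => v; rewrite h.
have [hf|/existsNP[u /not_implyP[Lu /eqP fu]]] :=
    pselect (forall v, joint_kernel L v -> f v = 0).
  exists 0; rewrite scale0r subr0; apply: IH => v Lv; apply: h.
  by apply/joint_kernel_cons; split=> //; exact: hf.
exists (g u / f u); apply: IH => v Lv; rewrite dualB dualZ.
have : g (v - (f v / f u) *: u) = 0.
  apply: h; apply/joint_kernel_cons; split.
    by rewrite linearB linearZ /= /GRing.scale /= -mulrA mulVf// mulr1 subrr.
  rewrite addrC -scaleNr; exact: (joint_kernel_subspace L).2.
rewrite linearB linearZ /= /GRing.scale /= => /eqP; rewrite subr_eq0 => /eqP ->.
by apply/eqP; rewrite subr_eq0; apply/eqP; field.
Qed.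

(** The finite codimension of Y is used through this: a subspace that meets Y
    trivially has a finite spanning list. *)
Lemma finite_dim_complement (V : lmodType R) (Y Q : set V) (es : seq V) :
  subspace Y -> subspace Q -> Y `&` Q `<=` [set 0] -> Q `<=` plus_span Y es ->
  exists L : seq V, (forall w, w \in L -> Q w) /\ Q `<=` plus_span [set 0] L.
Proof.
move=> Ysub; elim: es Q => [Q Qsub YQ QY|e es IH Q Qsub YQ Qes].
  by exists [::]; split=> // w Qw; apply: YQ; split=> //; exact: QY.
have Es := plus_span_subspace es Ysub.
pose Q' := Q `&` plus_span Y es.
have [||L [LQ' Q'L]] := IH Q' _ _ (@subIsetr _ _ _).
- split; first by split; [exact: Qsub.1|exact: Es.1].
  by move=> a x y [? ?] [? ?]; split; [exact: Qsub.2|exact: Es.2].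
- by move=> w [Yw [Qw _]]; exact: YQ.
have [QE|/existsNP[w /not_implyP[Qw nEw]]] := pselect (Q `<=` plus_span Y es).
  exists L; split=> [w /LQ'[]//|w Qw]; apply: Q'L; split=> //; exact: QE.
exists (w :: L); split=> [u|u Qu].
  by rewrite in_cons => /orP[/eqP ->//|/LQ'[]].
have [c wc] := Qes _ Qw; have [d ud] := Qes _ Qu.
have c0 : c != 0.
  by apply/eqP => c0; apply: nEw; move: wc; rewrite c0 scale0r subr0.
exists (d / c); apply: Q'L; split.
  by rewrite addrC -scaleNr; exact: Qsub.2.
have := Es.2 (- (d / c)) _ _ wc ud.
have -> // : - (d / c) *: (w - c *: e) + (u - d *: e) = u - (d / c) *: w.
rewrite scalerBr scalerA mulNr -mulrA mulVf// mulr1 !scaleNr opprK addrACA.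
by rewrite subrr addr0 addrC.
Qed.

End DualSpace.

(** * Weak* sequential density of total subspaces *)

Section WeakStarSequences.
Context {R : realType}.

Definition wstar_cvg (V : normedModType R) (f_ : nat -> dual V) (f : dual V) :=
  forall x, (fun n => f_ n x) @ \oo --> f x.

Definition total_subspace (V : normedModType R) (G : set (dual V)) : Prop :=
  subspace G /\ forall x, (forall g, G g -> g x = 0) -> x = 0.

Lemma separable_sequence (V : normedModType R) : separable V ->
  exists a : nat -> V, forall x e, 0 < e -> exists n, `|x - a n| < e.
Proof.
move=> [A /countable_injP[f finj] dA].
have /choice[a aP] n : exists x : V, forall y, A y -> f y = n -> x = y.
  have [[x Ax fx]|nx] := pselect (exists2 x, A x & f x = n).
    by exists x => y Ay fy; apply: finj; rewrite ?inE// fx.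
  by exists 0 => y Ay fy; exfalso; apply: nx; exists y.
exists a => x e e0.
have [y [xy Ay]] : ball x e `&` A !=set0.
  apply: dA; last exact: ball_open.
  by exists x; exact: ballxx.
exists (f y); rewrite (aP _ y Ay erefl).
by move: xy; rewrite -ball_normE.
Qed.

(** By density, x may be replaced by a term of the sequence a, at a cost that is bounded
    uniformly in n. *)
Lemma bounded_wstar_cvg0 (V : normedModType R) (a : nat -> V)
    (e_ : nat -> dual V) (C : R) :
  (forall x e, 0 < e -> exists n, `|x - a n| < e) ->
  (forall n, `|e_ n| <= C) -> (forall n i, (i < n)%N -> e_ n (a i) = 0) ->
  wstar_cvg e_ 0.
Proof.
move=> ad eC ea x; rewrite dual0; apply/cvgrPdist_lt => d d0.
have C1 : 0 < C + 1 by rewrite ltr_wpDl// (le_trans _ (eC 0%N)).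
have [i xi] := ad x _ (divr_gt0 d0 C1).
near=> n; rewrite sub0r normrN.
have -> : e_ n x = e_ n (x - a i).
  rewrite linearB /= (ea n i) ?subr0//.
  by near: n; exact: nbhs_infty_gt.
rewrite (le_lt_trans (dual_ler _ _))//.
rewrite (@le_lt_trans _ _ ((C + 1) * `|x - a i|))//.
  by rewrite ler_wpM2r// (le_trans (eC n))// lerDl.
by rewrite mulrC -ltr_pdivlMr.
Unshelve. all: by end_near. Qed.

Lemma canonical_range_subspace (V : normedModType R) :
  subspace (range (@canonical_embedding R V)).
Proof.
split; first by exists 0 => //; apply: dual_ext => f /=; rewrite linear0.
move=> a _ _ [x _ <-] [y _ <-]; exists (a *: x + y) => //.
by apply: dual_ext => f; rewrite dualD dualZ /= linearP.
Qed.

Lemma plus_span_canonical (V : normedModType R) (L : seq (dual (dual V)))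
    (a : nat -> V) (n : nat) (F : dual (dual V)) :
  plus_span [set 0] ([seq canonical_embedding (a i) | i <- iota 0 n] ++ L) F ->
  plus_span (range (@canonical_embedding R V)) L F.
Proof.
have [_ Ls] := plus_span_subspace L (canonical_range_subspace V).
elim: (iota 0 n) F => [F|i s IH F [c /IH h]] /=.
  by apply: plus_spanS => _ ->; exact: (canonical_range_subspace V).1.
have := Ls c _ _ (@sub_plus_span _ _ _ L _ (ex_intro2 _ _ (a i) I erefl)) h.
by rewrite addrC subrK.
Qed.

(** The subspace V + span L is closed, so F is at a distance at least e > 0 from it.
    Unless F takes the value 1 at some functional of norm at most 2 / e that vanishes on
    L and on the first n terms of a dense sequence of V, its restriction to the
    functionals that vanish there has norm at most e / 2.  An extension Psi with the same
    bound differs from F by an element of V + span L, which contradicts the distance. *)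
Lemma wstar_null_sequence (V : completeNormedModType R)
    (L : seq (dual (dual V))) (F : dual (dual V)) :
  separable V -> ~ plus_span (range (@canonical_embedding R V)) L F ->
  exists e_ : nat -> dual V, [/\ forall n, joint_kernel L (e_ n),
    forall n, F (e_ n) = 1 & wstar_cvg e_ 0].
Proof.
move=> /separable_sequence[a ad] nF.
have Xsub := canonical_range_subspace V.
have : ~ approximable (plus_span (range (@canonical_embedding R V)) L) F.
  move=> apF; apply: nF; apply: approximable_plus_span => // w.
  exact: approximable_canonical_embedding.
move=> /not_approximable[e e0 dist].
pose La n := [seq canonical_embedding (a i) | i <- iota 0 n] ++ L.
suff /choice[e_ e_P] n : exists f : dual V,
    [/\ joint_kernel (La n) f, F f = 1 & `|f| <= 2 / e].
  exists e_; split=> [n f fL|n|].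
  - have [h _ _] := e_P n; apply: h; by rewrite mem_cat fL orbT.
  - by have [] := e_P n.
  - apply: (bounded_wstar_cvg0 (C := 2 / e) ad) => [n|n i ni].
      by have [] := e_P n.
    have [/(_ (canonical_embedding (a i))) h _ _] := e_P n.
    by apply: h; rewrite mem_cat; apply/orP; left; apply/mapP; exists i; rewrite ?mem_iota.
apply: contrapT => nex.
have [KS0 KSL] := joint_kernel_subspace (La n).
have small f : joint_kernel (La n) f -> `|F f| <= e / 2 * `|f|.
  move=> Lf; rewrite leNgt; apply/negP => lt; apply: nex.
  have F0 : F f != 0.
    apply/eqP => F0; move: lt; rewrite F0 normr0 ltNge mulr_ge0//.
    by rewrite divr_ge0// ltW.
  exists ((F f)^-1 *: f); split.
  - by have := KSL (F f)^-1 _ _ Lf KS0; rewrite addr0.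
  - by rewrite linearZ /= /GRing.scale /= mulVf.
  - rewrite normrZ normfV ler_pdivrMl ?normr_gt0//.
    rewrite -ler_pdivrMr ?divr_gt0// invf_div mulrC; exact: ltW.
have [Psi [Psilin PsiF PsiB]] : exists Psi : dual V -> R^o, [/\ linear Psi,
    forall f, joint_kernel (La n) f -> Psi f = F f &
    forall f, `|Psi f| <= e / 2 * `|f|].
  pose G := [set u : dual V * R | joint_kernel (La n) u.1 /\ u.2 = F u.1].
  pose p (f : dual V) := e / 2 * `|f|.
  have pD f g : p (f + g) <= p f + p g.
    by rewrite /p -mulrDr ler_wpM2l ?ler_normD// divr_ge0// ltW.
  have pZ c f : p (c *: f) = `|c| * p f by rewrite /p normrZ mulrCA.
  have G0 : G !=set0 by exists (0, 0); split=> //=; rewrite linear0.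
  have Gd : dominated_linear_relation p G.
    split=> [c u v [Lu ->] [Lv ->]|u [Lu ->]].
      by split; [exact: KSL|rewrite /= linearP].
    exact: le_trans (ler_norm _) (small _ Lu).
  have [Psi [Plin PG PB]] := hahn_banach pD pZ G0 Gd.
  by exists Psi; split=> // f Lf; exact: (PG (f, F f)).
have [Ps PsE] := dual_of_bounded Psilin PsiB.
suff /dist : plus_span (range (@canonical_embedding R V)) L (F - Ps).
  rewrite opprB addrC subrK leNgt => /negP; apply.
  rewrite (@le_lt_trans _ _ (e / 2))//; last by lra.
  by apply: dual_normE => [|f]; rewrite ?PsE// divr_ge0// ltW.
apply: (plus_span_canonical (a := a) (n := n)); apply: joint_kernel_span => f Lf.
by rewrite dualB PsE PsiF// subrr.
Qed.

(** The annihilator Q of G in the bidual meets V trivially because G is total, so it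
    is spanned by a finite list L, and the norm closure of G is the joint kernel of L.
    Removing one functional F from L may enlarge this kernel, but then F is outside
    V + span of the others (again because Q meets V trivially), and each new element f
    is the limit of f - F f *: e_n for a weak* null sequence e_n with F e_n = 1.
    After finitely many removals the kernel is the whole dual.  S is a set, and not a
    subspace, because it will consist of the solutions of nonlinear equations. *)
Theorem total_subspace_wstar_dense (V : completeNormedModType R)
    (G S : set (dual V)) :
  separable V -> quasireflexive V -> total_subspace G -> G `<=` S ->
  (forall (f_ : nat -> dual V) f, (forall n, S (f_ n)) -> wstar_cvg f_ f -> S f) ->
  forall f, S f.
Proof.
move=> Vsep [N [es esP]] [Gsub Gtot] GS Scl.
pose Q : set (dual (dual V)) := [set F | forall g, G g -> F g = 0].
have Qsub : subspace Q.
  split=> [g _|c F F' QF QF' g Gg] //.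
  by rewrite dualD dualZ QF// QF'// mulr0 addr0.
have QX x : Q (canonical_embedding x) -> x = 0 by move=> h; apply: Gtot.
have [|F QF|L [LQ QL]] := finite_dim_complement (es := [seq es i | i <- enum 'I_N])
  (canonical_range_subspace V) Qsub.
- by move=> _ [[x _ <-] /QX ->]; apply: dual_ext => f /=; rewrite linear0.
- have [x [c ->]] := esP F.
  rewrite -big_enum /=.
  elim: (enum 'I_N) => [|i s IH] /=; first by rewrite big_nil addr0; exists x.
  exists (c i); rewrite big_cons.
  by rewrite [c i *: _ + _]addrC addrA addrK.
have : joint_kernel L `<=` S.
  move=> f Lf.
  suff /choice[g gP] n : exists g : dual V, G g /\ `|f - g| < n.+1%:R^-1.
    apply: (Scl g) => [n|x]; first by apply: GS; have [] := gP n.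
    apply/cvgrPdist_lt => e e0; near=> n.
    rewrite -dualB (le_lt_trans (dual_ler _ _))//.
    rewrite (@le_lt_trans _ _ (n.+1%:R^-1 * (`|x| + 1)))//.
      by rewrite ler_pM// ?lerDl// ltW//; have [] := gP n.
    rewrite -ltr_pdivlMr; last by rewrite ltr_wpDl.
    near: n; have h' : 0 < e / (`|x| + 1) by rewrite divr_gt0// ltr_wpDl.
    exact: near_infty_natSinv_lt (PosNum h').
  have : approximable G f.
    apply: contrapT => /not_approximable[e e0 dist].
    have [F [FG F1 _]] := dual_separation Gsub e0 dist.
    have := span_joint_kernel (QL _ FG) Lf.
    by rewrite F1 => /eqP; rewrite oner_eq0.
  move=> /(_ n.+1%:R^-1)[|g Gg lt]; first by rewrite invr_gt0.
  by exists g.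
elim: L LQ {QL} => [_ h f|F L IH LQ FLS f]; first exact: h.
apply: IH f => [w wL|f Lf]; first by apply: LQ; rewrite in_cons wL orbT.
have [LF|nLF] := pselect (forall u, joint_kernel L u -> F u = 0).
  by apply: FLS; apply/joint_kernel_cons; split=> //; exact: LF.
have QF : Q F by apply: LQ; rewrite mem_head.
have [e_ [eL eF e0]] : exists e_ : nat -> dual V,
    [/\ forall n, joint_kernel L (e_ n), forall n, F (e_ n) = 1 & wstar_cvg e_ 0].
  apply: wstar_null_sequence => // /plus_span_split[_ [x _ <-] FL].
  apply: nLF.
  suff x0 : x = 0.
    move: FL; rewrite x0 (_ : canonical_embedding 0 = 0) ?subr0; last first.
      by apply: dual_ext => g /=; rewrite linear0.
    exact: span_joint_kernel.
  apply: QX => g Gg.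
  have Lg : joint_kernel L g by move=> w wL; apply: LQ => //; rewrite in_cons wL orbT.
  have := span_joint_kernel FL Lg; rewrite dualB QF// sub0r => /eqP.
  by rewrite oppr_eq0 => /eqP.
apply: (Scl (fun n => f - F f *: e_ n)) => [n|x].
  apply: FLS; apply/joint_kernel_cons; split.
    by rewrite linearB linearZ /= eF /GRing.scale /= mulr1 subrr.
  by rewrite addrC -scaleNr; exact: (joint_kernel_subspace L).2.
rewrite -[X in _ --> X](subr0 (f x)) -(mulr0 (F f)).
under eq_fun do rewrite dualB dualZ.
by apply: cvgB; [exact: cvg_cst|apply: cvgM; [exact: cvg_cst|exact: e0]].
Unshelve. all: by end_near. Qed.

End WeakStarSequences.

(** * Complex exponential and logarithm *)

Section ComplexExponential.
Context {R : realType}.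
Implicit Types z w : R[i].

Lemma complex_ext z w : Re z = Re w -> Im z = Im w -> z = w.
Proof. by case: z w => a b [c d] /= -> ->. Qed.

Lemma ReD z w : Re (z + w) = Re z + Re w.
Proof. by case: z w => a b [c d]. Qed.
Lemma ImD z w : Im (z + w) = Im z + Im w.
Proof. by case: z w => a b [c d]. Qed.
Lemma ImN z : Im (- z) = - Im z. Proof. by case: z. Qed.
Lemma ReM z w : Re (z * w) = Re z * Re w - Im z * Im w.
Proof. by case: z w => a b [c d]. Qed.
Lemma ImM z w : Im (z * w) = Re z * Im w + Im z * Re w.
Proof. by case: z w => a b [c d]. Qed.

Lemma cexpE z : cexp z = (expR (Re z) * cos (Im z)) +i* (expR (Re z) * sin (Im z)).
Proof. by rewrite /cexp; apply: complex_ext; rewrite ?ReM ?ImM /=; ring. Qed.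

Lemma cexpD z w : cexp (z + w) = cexp z * cexp w.
Proof.
rewrite !cexpE ReD ImD expRD cosD sinD; apply: complex_ext;
  rewrite ?ReM ?ImM /=; ring.
Qed.

Lemma cexp0 : cexp 0 = 1 :> R[i].
Proof. by rewrite cexpE /= expR0 cos0 sin0 mulr1 mulr0. Qed.

Lemma cexp_neq0 z : cexp z != 0.
Proof.
apply/eqP => h; have := cexpD z (- z); rewrite subrr cexp0 h mul0r => /eqP.
by rewrite oner_eq0.
Qed.

Lemma cexpB z w : cexp (z - w) = cexp z / cexp w.
Proof.
by apply: (mulIf (cexp_neq0 w)); rewrite -cexpD subrK mulfVK// cexp_neq0.
Qed.

(** This is what turns an identity between exponentials into one between exponents,
    when the exponents are known to be small. *)
Lemma cexp_eq1 z : cexp z = 1 -> `|Im z| < pi -> z = 0.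
Proof.
rewrite cexpE => /eqP; rewrite eq_complex /= => /andP[/eqP c1 /eqP s0] lt.
have I0 : Im z = 0.
  have sin0 : sin (Im z) = 0.
    by apply/eqP; move/eqP: s0; rewrite mulf_eq0 gt_eqF ?expR_gt0.
  apply/eqP; case: (ltgtP (Im z) 0) => // I0.
    have : 0 < sin (- Im z) by apply: sin_gt0_pi; rewrite oppr_gt0 I0 -ltr0_norm.
    by rewrite sinN sin0 oppr0 ltxx.
  have : 0 < sin (Im z) by apply: sin_gt0_pi; rewrite I0 -(gtr0_norm I0).
  by rewrite sin0 ltxx.
apply: complex_ext => //=.
move: c1; rewrite I0 cos0 mulr1 -expR0; exact: expR_inj.
Qed.

(** The principal logarithm; the formula is valid on the right half-plane. *)
Definition clog z : R[i] :=
  ln (Num.sqrt (Re z ^+ 2 + Im z ^+ 2)) +i* atan (Im z / Re z).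

Lemma clogK z : 0 < Re z -> cexp (clog z) = z.
Proof.
move=> z0; rewrite cexpE /=.
have s0 : 0 < Re z ^+ 2 + Im z ^+ 2 by rewrite ltr_pwDl ?exprn_gt0// sqr_ge0.
rewrite lnK ?posrE ?sqrtr_gt0//.
set s := Num.sqrt _.
have cE : cos (atan (Im z / Re z)) = Re z / s.
  have -> : s = Re z * Num.sqrt (1 + (Im z / Re z) ^+ 2).
    rewrite -[X in X * _](ger0_norm (ltW z0)) -sqrtr_sqr -sqrtrM ?sqr_ge0//.
    by congr Num.sqrt; field; exact: lt0r_neq0.
  by rewrite cos_atan invfM mulrA mulfV ?mul1r// lt0r_neq0.
have sE : sin (atan (Im z / Re z)) = Im z / s.
  have := atanK (Im z / Re z); rewrite /tan => /(canRL (divfK _)) ->.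
    by rewrite cE mulrA mulfVK// lt0r_neq0.
  by rewrite cE mulf_neq0// ?invr_eq0 ?lt0r_neq0// sqrtr_gt0.
have sn : s != 0 by rewrite lt0r_neq0// sqrtr_gt0.
by rewrite cE sE; apply: complex_ext => /=; rewrite mulrC mulfVK.
Qed.

End ComplexExponential.

(** * Iterated differences *)

Section Differences.
Context {R : realType} {V : zmodType}.
Implicit Types (u v : V -> R[i]) (h t : V).

Definition mdiff h u : V -> R[i] := fun t => u (t + h) / u t.

Lemma mdiff1 h : mdiff h (fun=> 1) = fun=> 1.
Proof. by apply/funext => t; rewrite /mdiff divr1. Qed.

Lemma mdiffM h u v : mdiff h (fun t => u t * v t) = fun t => mdiff h u t * mdiff h v t.
Proof. by apply/funext => t; rewrite /mdiff invfM; ring. Qed.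

Lemma mdiffC h k u : mdiff h (mdiff k u) = mdiff k (mdiff h u).
Proof.
apply/funext => t; rewrite /mdiff !invfM !invrK.
by rewrite [t + h + k]addrAC; ring.
Qed.

Lemma mdiff_neq0 h u : (forall t, u t != 0) -> forall t, mdiff h u t != 0.
Proof. by move=> u0 t; rewrite /mdiff mulf_neq0 ?invr_eq0. Qed.

Lemma mdiff_cexp h u : mdiff h (fun t => cexp (u t)) = fun t => cexp (forward_difference h u t).
Proof. by apply/funext => t; rewrite /mdiff -cexpB. Qed.

Lemma iter_mdiff_cexp n h u :
  iter n (mdiff h) (fun t => cexp (u t)) =
  fun t => cexp (iter n (forward_difference h) u t).
Proof. by elim: n => //= n ->; rewrite mdiff_cexp. Qed.

Lemma iter_mdiffM n h u v :
  iter n (mdiff h) (fun t => u t * v t) =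
  fun t => iter n (mdiff h) u t * iter n (mdiff h) v t.
Proof. by elim: n => //= n ->; rewrite mdiffM. Qed.

(** Allows to replace a function by the exponential of a logarithm that exists only
    locally. *)
Lemma eq_iter_mdiff n h u v t :
  (forall j, (j <= n)%N -> u (t + h *+ j) = v (t + h *+ j)) ->
  iter n (mdiff h) u t = iter n (mdiff h) v t.
Proof.
elim: n u v => [|n IH] u v uv; first by have := uv 0%N (leqnn _); rewrite mulr0n addr0.
rewrite !iterSr; apply: IH => j jn; rewrite /mdiff uv ?(leq_trans jn)//.
by rewrite -addrA -mulrSr uv.
Qed.

(** The equation of order n expresses the value at t + n h by the n previous ones. *)
Lemma mdiff_propagate n h u t :
  (forall j, (j < n)%N -> u (t + h *+ j) = 1) -> iter n (mdiff h) u t = 1 ->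
  u (t + h *+ n) = 1.
Proof.
elim: n u => [|n IH] u u1; first by rewrite mulr0n addr0.
rewrite iterSr => /IH; rewrite /mdiff -addrA -mulrSr u1// divr1; apply=> j jn.
by rewrite -addrA -mulrSr !u1 ?divr1// ltnS ltnW.
Qed.

Lemma mdiff_lattice n h u t :
  (forall j, (j < n)%N -> u (t + h *+ j) = 1) ->
  (forall s, iter n (mdiff h) u s = 1) -> forall k, u (t + h *+ k) = 1.
Proof.
move=> u1 un; elim/ltn_ind => k IH.
have [/u1//|nk] := ltnP k n.
rewrite -(subnK nk) mulrnDr addrA; apply: mdiff_propagate => // j jn.
rewrite -addrA -mulrnDr; apply: IH.
by rewrite -[ltnRHS](subnK nk) ltn_add2l.
Qed.

Lemma fdiff_propagate n h u t :
  (forall j, (j < n)%N -> u (t + h *+ j) = 0) -> iter n (forward_difference h) u t = 0 ->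
  u (t + h *+ n) = 0.
Proof.
elim: n u => [|n IH] u u1; first by rewrite mulr0n addr0.
rewrite iterSr => /IH; rewrite /forward_difference -addrA -mulrSr u1// subr0; apply=> j jn.
by rewrite -addrA -mulrSr !u1 ?subr0// ltnS ltnW.
Qed.

Lemma iter_fdiffB n h u v t :
  iter n (forward_difference h) (fun s => u s - v s) t =
  iter n (forward_difference h) u t - iter n (forward_difference h) v t.
Proof.
elim: n t => //= n IH t; rewrite /forward_difference !IH; ring.
Qed.

Lemma iter_fdiff_bound n h u t e :
  (forall j, (j <= n)%N -> `|Im (u (t + h *+ j))| <= e) ->
  `|Im (iter n (forward_difference h) u t)| <= 2 ^+ n * e.
Proof.
elim: n u e => [|n IH] u e ue.
  by have := ue 0%N (leqnn _); rewrite mulr0n addr0 expr0 mul1r.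
rewrite iterSr exprSr -mulrA; apply: IH => j jn.
rewrite /forward_difference ImD ImN (le_trans (ler_normB _ _))// mulr2n mulrDl mul1r.
by rewrite lerD ?ue ?(leq_trans jn)// -addrA -mulrSr ue.
Qed.

End Differences.

(** * Local polynomials *)

Section PolynomialExponent.
Context {R : realType}.
Implicit Types (p q : {poly R[i]}) (h t : R) (u : R -> R[i]).

(** Newton's scheme: the next node is matched by adding a multiple of a polynomial
    that vanishes at the earlier nodes. *)
Lemma interpolation (x : nat -> R[i]) (g : nat -> R[i]) n : injective x ->
  exists p, (size p <= n)%N /\ forall j, (j < n)%N -> p.[x j] = g j.
Proof.
move=> xinj; elim: n => [|n [p [ps pE]]]; first by exists 0; rewrite size_poly0.
pose w := \prod_(j < n) ('X - (x j)%:P).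
have ws : size w = n.+1 by rewrite size_prod_XsubC /index_enum -enumT size_enum_ord.
have w0 : w.[x n] != 0.
  rewrite horner_prod; apply/prodf_neq0 => j _; rewrite hornerXsubC subr_eq0.
  by apply/eqP => /xinj jn; have := ltn_ord j; rewrite -jn ltnn.
exists (p + ((g n - p.[x n]) / w.[x n]) *: w); split.
  rewrite (leq_trans (size_polyD _ _))// geq_max (leq_trans ps)//=.
  by rewrite (leq_trans (size_scale_leq _ _))// ws.
move=> j; rewrite ltnS leq_eqVlt => /orP[/eqP ->|jn].
  by rewrite hornerD hornerZ divfK// addrC subrK.
have wj : w.[x j] = 0.
  by rewrite horner_prod (bigD1 (Ordinal jn))//= hornerXsubC subrr mul0r.
by rewrite hornerD hornerZ pE// wj mulr0 addr0.
Qed.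

Lemma poly_eq_lattice (x : nat -> R[i]) p q n : injective x ->
  (size p <= n)%N -> (size q <= n)%N ->
  (forall j, (j < n)%N -> p.[x j] = q.[x j]) -> p = q.
Proof.
move=> xinj ps qs pq; apply/eqP; rewrite -subr_eq0; apply: contraT => pq0.
have rs : all (root (p - q)) (map x (iota 0 n)).
  apply/allP => _ /mapP[j + ->]; rewrite mem_iota /= add0n => jn.
  by rewrite rootE hornerD hornerN pq// subrr.
have us : uniq (map x (iota 0 n)) by rewrite map_inj_uniq// iota_uniq.
have := max_poly_roots pq0 rs us; rewrite size_map size_iota.
by rewrite ltnNge (leq_trans (size_polyD _ _))// size_polyN geq_max ps qs.
Qed.

Lemma size_poly_shift p (c : R[i]) n : (size p <= n.+1)%N ->
  (size (p \Po ('X + c%:P) - p)%R <= n)%N.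
Proof.
elim/poly_ind: p n => [|p a IH] n; first by rewrite comp_poly0 subr0 size_poly0.
rewrite size_MXaddC; case: ifP => [/andP[/eqP -> /eqP ->]|_].
  by rewrite mul0r add0r comp_polyC subrr size_poly0.
rewrite ltnS => pn.
have -> : (p * 'X + a%:P) \Po ('X + c%:P) - (p * 'X + a%:P) =
    (p \Po ('X + c%:P) - p) * 'X + c *: (p \Po ('X + c%:P)).
  rewrite comp_polyD comp_polyC comp_polyM comp_polyX mulrDr mulrBl.
  rewrite [_ * c%:P]mulrC mul_polyC opprD addrACA subrr addr0.
  by rewrite addrAC.
case: n pn => [|n pn].
  rewrite leqn0 size_poly_eq0 => /eqP ->.
  by rewrite comp_poly0 subr0 mul0r scaler0 addr0 size_poly0.
rewrite (leq_trans (size_polyD _ _))// geq_max; apply/andP; split.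
  by rewrite (leq_trans (size_polyMleq _ _))// size_polyX addn2 /= ltnS IH.
rewrite (leq_trans (size_scale_leq _ _))//.
by rewrite size_comp_poly2// size_XaddC.
Qed.

Lemma fdiff_poly n p h t : (size p <= n)%N ->
  iter n (forward_difference h) (fun s : R => p.[s%:C]) t = 0.
Proof.
elim: n p t => [|n IH] p t ps.
  by move: ps; rewrite leqn0 size_poly_eq0 => /eqP -> /=; rewrite horner0.
rewrite iterSr -(IH _ t (size_poly_shift h%:C ps)).
congr (iter n (forward_difference h) _ t); apply/funext => s.
rewrite /forward_difference hornerD hornerN horner_comp hornerD hornerX hornerC.
by congr (_.[_] - _); apply: complex_ext => /=; rewrite ?addr0.
Qed.

Lemma lattice_inj h t : h != 0 -> injective (fun j : nat => (t + h *+ j)%:C).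
Proof.
move=> h0 i j /(congr1 (@Re R)) /= /addrI.
rewrite -[h *+ i]mulr_natl -[h *+ j]mulr_natl => /(mulIf h0) /eqP.
by rewrite eqr_nat => /eqP.
Qed.

(** The polynomial that interpolates the first n values solves the same difference
    equation of order n, which determines all later values. *)
Lemma lattice_poly n K h u : h != 0 ->
  (forall k, (k + n <= K)%N -> iter n (forward_difference h) u (h *+ k) = 0) ->
  exists p, (size p <= n)%N /\ forall k, (k <= K)%N -> u (h *+ k) = p.[(h *+ k)%:C].
Proof.
move=> h0 un; pose x j := (0 + h *+ j)%:C.
have [p [ps pE]] := interpolation (fun j => u (h *+ j)) n (@lattice_inj h 0 h0).
exists p; split=> //; elim/ltn_ind => k IH kK.
have [/pE|nk] := ltnP k n; first by rewrite add0r.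
apply/eqP; rewrite -subr_eq0 -(subnK nk) mulrnDr; apply/eqP.
apply: (@fdiff_propagate _ _ n h (fun s => u s - p.[s%:C])) => [j jn|].
  rewrite -mulrnDr IH ?subrr//; first by rewrite -[ltnRHS](subnK nk) ltn_add2l.
  by rewrite (leq_trans _ kK)// -[leqRHS](subnK nk) leq_add2l ltnW.
by rewrite iter_fdiffB un ?subnK// fdiff_poly// subrr.
Qed.

Lemma horner_Re_continuous p : continuous (fun t : R => Re p.[t%:C]) /\
  continuous (fun t : R => Im p.[t%:C]).
Proof.
elim/poly_ind: p => [|p a [IHr IHi]].
  by split; under eq_fun do rewrite horner0; exact: cst_continuous.
split; under eq_fun do rewrite hornerMXaddC ?ReD ?ImD ?ReM ?ImM /= mulr0 ?subr0 ?add0r;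
  move=> t; apply: cvgD; try exact: cvg_cst; apply: cvgM => //; (exact: IHr || exact: IHi).
Qed.

Lemma continuous_eq0_dense (f : R -> R) (t : R) (s : nat -> R) :
  {for t, continuous f} -> (forall n, f (s n) = 0) -> s @ \oo --> t -> f t = 0.
Proof.
move=> cf fs st.
have h : (fun n => f (s n)) @ \oo --> f t by apply: continuous_cvg.
have h0 : (fun n => f (s n)) @ \oo --> (0 : R).
  by under eq_fun do rewrite fs; exact: cvg_cst.
exact: cvg_unique h h0.
Qed.

(** A local form of Frechet's theorem.  On each of the lattices of mesh
    d / (n.+1 * j.+1), u agrees with a polynomial of size at most n.+1; all these
    lattices contain the coarsest one, which has enough points to force the polynomials
    to be equal.  Continuity fills the gaps. *)
Lemma local_frechet n (d : R) u : 0 < d ->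
  (forall t, 0 <= t <= d -> {for t, continuous (fun s => Re (u s))} /\
                           {for t, continuous (fun s => Im (u s))}) ->
  (forall h t, 0 < h -> 0 <= t -> t + h *+ n.+1 <= d ->
     iter n.+1 (forward_difference h) u t = 0) ->
  exists p, forall t, 0 <= t <= d -> u t = p.[t%:C].
Proof.
move=> d0 cu un.
pose h j := d / (n.+1 * j.+1)%:R.
have h0 j : 0 < h j by rewrite divr_gt0// ltr0n muln_gt0.
have hd j : h j *+ (n.+1 * j.+1) = d.
  by rewrite -mulr_natr /h divfK// pnatr_eq0 muln_eq0.
have lat j : exists p, (size p <= n.+1)%N /\
    forall k, (k <= n.+1 * j.+1)%N -> u (h j *+ k) = p.[(h j *+ k)%:C].
  apply: lattice_poly => [|k kK]; first by rewrite lt0r_neq0.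
  apply: un => //; first by rewrite mulrn_wge0// ltW.
  by rewrite -mulrnDr -(hd j) ler_wpMn2l// ltW.
have [p [ps pE]] := lat 0%N.
have pj j k : (k <= n.+1 * j.+1)%N -> u (h j *+ k) = p.[(h j *+ k)%:C].
  have [q [qs qE]] := lat j.
  suff -> : p = q by exact: qE.
  apply: (poly_eq_lattice (@lattice_inj (h 0%N) 0 (lt0r_neq0 (h0 0%N))) ps qs).
  move=> i i_n.
  have hj : h 0%N = h j *+ j.+1.
    rewrite /h muln1 natrM -[RHS]mulr_natr invfM mulrA divfK// pnatr_eq0//.
  rewrite add0r -pE ?muln1 1?ltnW// hj -mulrnA qE// mulnC leq_mul2r.
  by rewrite (ltnW i_n) orbT.
exists p => t /andP[t0 td].
pose s j := h j *+ Num.truncn (t / h j).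
have sE j : 0 <= t - s j <= d / j.+1%:R.
  have := truncn_itv (divr_ge0 t0 (ltW (h0 j))).
  rewrite ler_pdivlMr// ltr_pdivrMr// => /andP[].
  rewrite /s -[h j *+ _]mulr_natl subr_ge0 => -> /ltW; rewrite -natr1 mulrDl mul1r => le.
  rewrite lerBlDl (le_trans le)// lerD2l /h ler_pM2l// lef_pV2 ?posrE// ?ltr0n ?muln_gt0//.
  by rewrite ler_nat leq_pmull.
have us j : u (s j) = p.[(s j)%:C].
  apply: pj; rewrite -(ler_nat R) (le_trans (y := t / h j))//.
    by have /andP[] := truncn_itv (divr_ge0 t0 (ltW (h0 j))).
  by rewrite ler_pdivrMr// (le_trans td)// mulr_natl hd.
have st : s @ \oo --> t.
  apply/cvgrPdist_lt => e e0.
  have e' : 0 < e / d by rewrite divr_gt0.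
  near=> j; have /andP[s1 s2] := sE j; rewrite ger0_norm// (le_lt_trans s2)//.
  rewrite -ltr_pdivlMl// [ltRHS]mulrC.
  by near: j; exact: near_infty_natSinv_lt (PosNum e').
have [cr ci] := cu t (introT andP (conj t0 td)).
have [pr pi] := horner_Re_continuous p.
apply: complex_ext; apply/eqP; rewrite -subr_eq0; apply/eqP.
- apply: (continuous_eq0_dense (f := fun t => Re (u t) - Re p.[t%:C]) _ _ st).
    by apply: continuousB => //; exact: pr.
  by move=> j; rewrite us subrr.
- apply: (continuous_eq0_dense (f := fun t => Im (u t) - Im p.[t%:C]) _ _ st).
    by apply: continuousB => //; exact: pi.
  by move=> j; rewrite us subrr.
Unshelve. all: by end_near. Qed.

End PolynomialExponent.

(** * Exponentials of polynomials *)

Section PolynomialLogarithm.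
Context {R : realType}.

Lemma continuous_clog (phi : R -> R[i]) (t : R) :
  {for t, continuous (fun s => Re (phi s))} ->
  {for t, continuous (fun s => Im (phi s))} -> 0 < Re (phi t) ->
  {for t, continuous (fun s => Re (clog (phi s)))} /\
  {for t, continuous (fun s => Im (clog (phi s)))}.
Proof.
move=> cr ci r0; split.
  apply: (@continuous_comp _ _ _
    (fun s => Num.sqrt (Re (phi s) ^+ 2 + Im (phi s) ^+ 2)) (@ln R)); last first.
    by apply: continuous_ln; rewrite sqrtr_gt0 ltr_pwDl ?exprn_gt0// sqr_ge0.
  apply: (@continuous_comp _ _ _
    (fun s => Re (phi s) ^+ 2 + Im (phi s) ^+ 2) (@Num.sqrt R)); last exact: sqrt_continuous.
  by apply: continuousD; apply: continuousM.
apply: (@continuous_comp _ _ _ (fun s => Im (phi s) / Re (phi s)) (@atan R)); last first.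
  exact: continuous_atan.
apply: continuousM => //; apply: continuousV => //; exact: lt0r_neq0.
Qed.

(** Near 0 the principal logarithm u of phi is so small that its differences of order
    n.+1, which are logarithms of 1, vanish; hence u is a polynomial p there.  The
    quotient phi / exp p then equals 1 on an interval and its differences are trivial,
    so the value 1 propagates along lattices to all of the line. *)
Theorem polynomial_logarithm n (phi : R -> R[i]) :
  continuous (fun s => Re (phi s)) -> continuous (fun s => Im (phi s)) ->
  phi 0 = 1 -> (forall h t, iter n.+1 (mdiff h) phi t = 1) ->
  exists p : {poly R[i]}, forall t, phi t = cexp p.[t%:C].
Proof.
move=> cr ci phi0 phin.
pose u t := clog (phi t).
(* A difference of order n.+1 adds up 2 ^ n.+1 values, so its imaginary part will be
   at most 1 < pi. *)
pose e : R := (2 ^+ n.+1)^-1.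
have e0 : 0 < e by rewrite invr_gt0 exprn_gt0.
have r0 : 0 < Re (phi 0) by rewrite phi0.
have [_ cu] := continuous_clog (cr 0) (ci 0) r0.
have [d d0 dP] : exists2 d, 0 < d & forall t, 0 <= t <= d ->
    0 < Re (phi t) /\ `|Im (u t)| <= e.
  have : \forall t \near (0 : R), 0 < Re (phi t) /\ `|Im (u t)| <= e.
    have r1 : \forall t \near (0 : R), 0 < Re (phi t) by apply: (cvgr_gt _ (cr 0)).
    have u0 : Im (u 0) = 0 by rewrite /u /clog phi0 /= mul0r atan0.
    have u1 : \forall t \near (0 : R), `|Im (u 0) - Im (u t)| < e.
      by have /cvgrPdist_lt /(_ e e0) := cu.
    near=> t; split; first by near: t.
    by rewrite -normrN -[- _]sub0r -u0 ltW//; near: t.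
  move=> /nbhs_ballP[d /= d0 h]; exists (d / 2); first by rewrite divr_gt0.
  move=> t /andP[t0 td]; apply: h; rewrite -ball_normE /ball_ /= sub0r normrN.
  by rewrite ger0_norm// (le_lt_trans td)// ltr_pdivrMr// mulr_natr mulr2n ltrDl.
have [p pE] : exists p : {poly R[i]}, forall t, 0 <= t <= d -> u t = p.[t%:C].
  apply: (@local_frechet _ n) => // [t /dP[rt _]|h t h0 t0 td].
    exact: continuous_clog (cr t) (ci t) rt.
  have inside j : (j <= n.+1)%N -> 0 <= t + h *+ j <= d.
    move=> jn; rewrite addr_ge0 ?mulrn_wge0 ?(ltW h0)//=.
    by rewrite (le_trans _ td)// lerD2l ler_wpMn2l// ltW.
  apply: cexp_eq1.
    have := iter_mdiff_cexp n.+1 h u; move/(congr1 (fun f => f t)) <-.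
    rewrite -[RHS](phin h t); apply: eq_iter_mdiff => j jn.
    by rewrite clogK//; have [] := dP _ (inside _ jn).
  rewrite (@le_lt_trans _ _ 1)//; last by rewrite (lt_le_trans _ (pi_ge2 R))// ltr1n.
  rewrite (_ : 1 = 2 ^+ n.+1 * e); last by rewrite mulfV// expf_neq0.
  by apply: iter_fdiff_bound => j jn; have [] := dP _ (inside _ jn).
exists p => t.
pose psi s := phi s * cexp (- p.[s%:C]).
have psi1 s : 0 <= s <= d -> psi s = 1.
  move=> sd; rewrite /psi -pE// -[phi s in LHS]clogK ?(dP _ sd).1//.
  by rewrite -cexpD subrr cexp0.
(* The polynomial may have any degree, so the order of the differences grows. *)
suff psit : psi t = 1.
  have := psit; rewrite /psi => /(congr1 (fun z => z * cexp p.[t%:C])).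
  by rewrite -mulrA -cexpD addNr cexp0 mulr1 mul1r.
pose m := maxn n.+1 (size p).
have psim h s : iter m (mdiff h) psi s = 1.
  rewrite /psi iter_mdiffM (iter_mdiff_cexp m h (fun s => - p.[s%:C])) /=.
  have -> : iter m (forward_difference h) (fun s : R => - p.[s%:C]) s = 0.
    rewrite (_ : (fun s => _) = (fun s : R => (- p).[s%:C])).
      by apply: fdiff_poly; rewrite size_polyN leq_maxr.
    by apply/funext => r; rewrite hornerN.
  have mE : m = (m - n.+1 + n.+1)%N by rewrite subnK// leq_maxl.
  rewrite cexp0 mulr1 mE iterD.
  rewrite (_ : iter n.+1 _ phi = fun=> 1); last by apply/funext => r; exact: phin.
  by elim: (m - _)%N s => //= k IH s; rewrite /mdiff !IH divr1.
have m0 : 0 < m%:R :> R by rewrite ltr0n (leq_trans _ (leq_maxl _ _)).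
(* From the middle of [0, d], steps of either sign stay in the interval. *)
pose b := d / 2.
have b0 : 0 < b by rewrite divr_gt0.
pose K := (Num.truncn (m%:R * `|t - b| / b)).+1.
have K0 : 0 < K%:R :> R by rewrite ltr0n.
have small : m%:R * (`|t - b| / K%:R) <= b.
  have := truncnS_gt (m%:R * `|t - b| / b); rewrite -/K => /ltW.
  by rewrite ler_pdivrMr// mulrA ler_pdivrMr// (mulrC b).
have tE : t = b + ((t - b) / K%:R) *+ K.
  by rewrite -mulr_natr divfK ?lt0r_neq0// addrC subrK.
rewrite tE; apply: (mdiff_lattice (n := m)) => // j jm.
apply: psi1.
have : `|((t - b) / K%:R) *+ j| <= b.
  rewrite normrMn normrM normfV (ger0_norm (ltW K0)) -[_ *+ j]mulr_natl.
  by rewrite (le_trans _ small)// ler_wpM2r ?divr_ge0 ?(ltW K0)// ler_nat ltnW.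
rewrite ler_norml => /andP[h1 h2].
have -> : d = b + b by rewrite /b -splitr.
by rewrite -lerBlDl sub0r h1 lerD2l.
Unshelve. all: by end_near. Qed.

End PolynomialLogarithm.

(** * Derivatives of the exponential of a polynomial *)

Section ComplexDerivative.
Context {R : realType}.

Definition has_derivative (f f' : R -> R) := forall s : R, is_derive s (1 : R) f (f' s).

Lemma has_derivative_ext (f g f' g' : R -> R) :
  f =1 g -> f' =1 g' -> has_derivative f f' -> has_derivative g g'.
Proof. by move=> /funext <- /funext <-. Qed.

Lemma has_derivative_cst (c : R) : has_derivative (fun=> c) (fun=> 0).
Proof. by move=> s; exact: is_derive_cst. Qed.

Lemma has_derivative_id : has_derivative id (fun=> 1).
Proof. by move=> s; exact: is_derive_id. Qed.

Lemma has_derivativeD (f g f' g' : R -> R) :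
  has_derivative f f' -> has_derivative g g' ->
  has_derivative (fun s => f s + g s) (fun s => f' s + g' s).
Proof. by move=> df dg s; exact: is_deriveD. Qed.

Lemma has_derivativeM (f g f' g' : R -> R) :
  has_derivative f f' -> has_derivative g g' ->
  has_derivative (fun s => f s * g s) (fun s => f s * g' s + g s * f' s).
Proof. by move=> df dg s; exact: is_deriveM. Qed.

Lemma has_derivativeN (f f' : R -> R) :
  has_derivative f f' -> has_derivative (fun s => - f s) (fun s => - f' s).
Proof. by move=> df s; exact: is_deriveN. Qed.

Lemma has_derivativeB (f g f' g' : R -> R) :
  has_derivative f f' -> has_derivative g g' ->
  has_derivative (fun s => f s - g s) (fun s => f' s - g' s).
Proof. by move=> df dg; apply: has_derivativeD => //; exact: has_derivativeN. Qed.

Lemma has_derivative_comp (f g f' g' : R -> R) :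
  has_derivative f f' -> has_derivative g g' ->
  has_derivative (fun s => g (f s)) (fun s => g' (f s) * f' s).
Proof. by move=> df dg s; exact: is_derive1_comp. Qed.

Lemma has_derivative_continuous (f f' : R -> R) :
  has_derivative f f' -> continuous f.
Proof.
move=> df s; apply: differentiable_continuous; apply/derivable1_diffP.
by have [] := df s.
Qed.

Lemma has_derivative_MVT (f f' : R -> R) (a b : R) : a <= b ->
  has_derivative f f' -> exists2 c, a <= c <= b & f b - f a = f' c * (b - a).
Proof.
move=> ab df; have [||c] := @MVT_segment R f f' a b ab; last by exists c.
- by move=> s _; exact: df.
- by apply: continuous_subspaceT; exact: has_derivative_continuous df.
Qed.

(** Derivatives of complex functions of a real variable are taken componentwise, so that
    the real mean value theorem applies to them. *)
Definition has_cderivative (g g' : R -> R[i]) :=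
  has_derivative (fun s => Re (g s)) (fun s => Re (g' s)) /\
  has_derivative (fun s => Im (g s)) (fun s => Im (g' s)).

Lemma has_cderivative_cst (c : R[i]) : has_cderivative (fun=> c) (fun=> 0).
Proof. by split; exact: has_derivative_cst. Qed.

Lemma has_cderivativeD (f g f' g' : R -> R[i]) :
  has_cderivative f f' -> has_cderivative g g' ->
  has_cderivative (fun s => f s + g s) (fun s => f' s + g' s).
Proof.
move=> [fr fi] [gr gi]; split.
  by apply: has_derivative_ext (has_derivativeD fr gr) => s /=; rewrite ReD.
by apply: has_derivative_ext (has_derivativeD fi gi) => s /=; rewrite ImD.
Qed.

Lemma has_cderivativeM (f g f' g' : R -> R[i]) :
  has_cderivative f f' -> has_cderivative g g' ->
  has_cderivative (fun s => f s * g s) (fun s => f' s * g s + f s * g' s).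
Proof.
move=> [fr fi] [gr gi]; split.
  apply: has_derivative_ext
    (has_derivativeB (has_derivativeM fr gr) (has_derivativeM fi gi)) => s /=.
    by rewrite ReM.
  by rewrite ReD !ReM; ring.
apply: has_derivative_ext
  (has_derivativeD (has_derivativeM fr gi) (has_derivativeM fi gr)) => s /=.
  by rewrite ImM.
by rewrite ImD !ImM; ring.
Qed.

Lemma has_cderivative_cexp (g g' : R -> R[i]) : has_cderivative g g' ->
  has_cderivative (fun s => cexp (g s)) (fun s => g' s * cexp (g s)).
Proof.
move=> [gr gi].
have de := has_derivative_comp gr (@is_derive_expR R).
have dc := has_derivative_comp gi (@is_derive_cos R).
have ds := has_derivative_comp gi (@is_derive_sin R).
split.
  apply: has_derivative_ext (has_derivativeM de dc) => s; first by rewrite cexpE.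
  by rewrite ReM cexpE /=; ring.
apply: has_derivative_ext (has_derivativeM de ds) => s; first by rewrite cexpE.
by rewrite ImM cexpE /=; ring.
Qed.

Lemma has_cderivative_line (a w : R[i]) :
  has_cderivative (fun s : R => a + w * s%:C) (fun=> w).
Proof.
have ds := @has_derivative_id.
split.
  apply: has_derivative_ext (has_derivativeD (has_derivative_cst (Re a))
    (has_derivativeM (has_derivative_cst (Re w)) ds)) => s /=.
    by rewrite ReD ReM /= mulr0 subr0.
  by rewrite mulr1 mulr0 addr0 add0r.
apply: has_derivative_ext (has_derivativeD (has_derivative_cst (Im a))
  (has_derivativeM (has_derivative_cst (Im w)) ds)) => s /=.
  by rewrite ImD ImM /= mulr0 add0r.
by rewrite mulr1 mulr0 addr0 add0r.
Qed.

Lemma has_cderivative_poly (p : {poly R[i]}) (g g' : R -> R[i]) :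
  has_cderivative g g' ->
  has_cderivative (fun s => p.[g s]) (fun s => g' s * p^`().[g s]).
Proof.
move=> dg; elim/poly_ind: p => [|p c IH].
  rewrite deriv0 (_ : (fun s => _) = fun=> 0); last by apply/funext => s; rewrite horner0.
  rewrite [X in _ _ X](_ : _ = fun=> 0); last by apply/funext => s; rewrite horner0 mulr0.
  exact: has_cderivative_cst.
have := has_cderivativeD (has_cderivativeM IH dg) (has_cderivative_cst c).
rewrite (_ : (fun s => _ + c) = fun s => (p * 'X + c%:P).[g s]); last first.
  by apply/funext => s; rewrite hornerMXaddC.
rewrite [X in _ _ X](_ : _ = fun s => g' s * (p * 'X + c%:P)^`().[g s])//.
apply/funext => s; rewrite derivMXaddC hornerD hornerM hornerX; ring.
Qed.

(** The polynomial factor of the k-th derivative of exp o p. *)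
Fixpoint exp_deriv (p : {poly R[i]}) (k : nat) : {poly R[i]} :=
  if k is k'.+1 then (exp_deriv p k')^`() + p^`() * exp_deriv p k' else 1.

(** The real part of the k-th derivative of s |-> c exp (p (a + w s)). *)
Definition line_deriv (p : {poly R[i]}) (c a w : R[i]) (k : nat) (s : R) : R :=
  Re (c * (w ^+ k * ((exp_deriv p k).[a + w * s%:C] * cexp p.[a + w * s%:C]))).

Lemma has_derivative_line (p : {poly R[i]}) (c a w : R[i]) k :
  has_derivative (line_deriv p c a w k) (line_deriv p c a w k.+1).
Proof.
have dl := has_cderivative_line a w.
have dP := has_cderivative_poly (exp_deriv p k) dl.
have dE := has_cderivative_cexp (has_cderivative_poly p dl).
have dW := has_cderivativeM (has_cderivative_cst (w ^+ k)) (has_cderivativeM dP dE).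
have [d _] := has_cderivativeM (has_cderivative_cst c) dW.
apply: has_derivative_ext d => // s; congr Re.
by rewrite /= hornerD hornerM exprS; ring.
Qed.

(** The sum over k of (r - s)^k / k! * g_k(s) has a telescoping derivative in s; the
    mean value theorem gives the remainder. *)
Lemma taylor (g : nat -> R -> R) (r : R) (N : nat) : 0 <= r ->
  (forall k, has_derivative (g k) (g k.+1)) ->
  exists2 x, 0 <= x <= r &
    g 0%N r = \sum_(k < N.+1) r ^+ k / k`!%:R * g k 0 +
              r * ((r - x) ^+ N / N`!%:R * g N.+1 x).
Proof.
move=> r0 dg.
pose T n s := \sum_(k < n.+1) (r - s) ^+ k / k`!%:R * g k s.
have dT : has_derivative (T N) (fun s => (r - s) ^+ N / N`!%:R * g N.+1 s).
  elim: N => [|n IH].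
    apply: has_derivative_ext (dg 0%N) => s; rewrite /T ?big_ord1 ?expr0 fact0 divr1 mul1r//.
  have dX : has_derivative (fun s => (r - s) ^+ n.+1) (fun s => - (n.+1%:R * (r - s) ^+ n)).
    have d1 := has_derivativeB (has_derivative_cst r) has_derivative_id.
    elim: n {IH} => [|n IH].
      by apply: has_derivative_ext d1 => s /=; rewrite ?expr1// expr0 mulr1 sub0r.
    apply: has_derivative_ext (has_derivativeM d1 IH) => s; first by rewrite -exprS.
    by rewrite /= -[in RHS]natr1 !exprS; move: (n.+1%:R) ((r - s) ^+ n) => a b; ring.
  have d2 := has_derivativeM (has_derivativeM dX (has_derivative_cst (n.+1`!%:R^-1))) (dg n.+1).
  apply: has_derivative_ext (has_derivativeD IH d2) => s.
    by rewrite /T [in RHS]big_ord_recr.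
  rewrite /= factS natrM invfM.
  have n1 : n.+1%:R != 0 :> R by rewrite pnatr_eq0.
  have f0 : n`!%:R != 0 :> R by rewrite pnatr_eq0 -lt0n fact_gt0.
  by field; rewrite f0 addrC natr1 n1.
have [x xr] := has_derivative_MVT r0 dT.
rewrite subr0 => E; exists x => //.
have Tr : T N r = g 0%N r.
  rewrite /T big_ord_recl big1 ?addr0 ?expr0 ?fact0 ?divr1 ?mul1r// => k _.
  by rewrite subrr expr0n /= !mul0r.
have T0 : T N 0 = \sum_(k < N.+1) r ^+ k / k`!%:R * g k 0.
  by apply: eq_bigr => k _; rewrite subr0.
by rewrite -Tr -T0 [r * _]mulrC -E addrC subrK.
Qed.

(** For u < 0 the remainder of the Taylor expansion of exp to an even order is at most
    0, so the partial sum is at least exp u. *)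
Lemma exp_partial_sum_ge0 (u : R) N :
  0 <= \sum_(k < (N + N).+1) u ^+ k / k`!%:R.
Proof.
have [u0|u0] := leP 0 u.
  by apply: sumr_ge0 => k _; rewrite divr_ge0 ?exprn_ge0.
pose g k (s : R) := u ^+ k * expR (u * s).
have dg k : has_derivative (g k) (g k.+1).
  have d1 := has_derivativeM (has_derivative_cst u) has_derivative_id.
  have d2 := has_derivative_comp d1 (@is_derive_expR R).
  apply: has_derivative_ext (has_derivativeM (has_derivative_cst (u ^+ k)) d2) => s //.
  by rewrite /= /g exprS; ring.
have [x /andP[x0 x1]] := taylor (N + N) (@ler01 R) dg.
rewrite /g mulr1 expr0 !mul1r.
under eq_bigr do rewrite expr1n mulr0 expR0 mulr1 mul1r mulrC.
set S := \sum_(k < _) _ => E.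
have -> : S = expR u - (1 - x) ^+ (N + N) / (N + N)`!%:R * (u ^+ (N + N).+1 * expR (u * x)).
  by rewrite E addrK.
rewrite addr_ge0 ?expR_ge0// oppr_ge0 mulr_ge0_le0//.
  by rewrite divr_ge0// exprn_ge0// subr_ge0.
rewrite mulr_le0_ge0 ?expR_ge0// exprS mulr_le0_ge0 ?(ltW u0)//.
by rewrite addnn -muln2 mulnC exprM exprn_ge0// sqr_ge0.
Qed.

Definition central_difference (h : R) (f : R -> R) : R -> R :=
  fun x => (f (x + h) - f (x - h)) / (2 * h).

Lemma has_derivative_shift (f f' : R -> R) (h : R) :
  has_derivative f f' -> has_derivative (fun s => f (s + h)) (fun s => f' (s + h)).
Proof.
move=> df.
have d1 := has_derivativeD has_derivative_id (has_derivative_cst h).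
by apply: has_derivative_ext (has_derivative_comp d1 df) => s //=; rewrite addr0 mulr1.
Qed.

(** An iterated central difference is a value of the derivative of that order: central
    differences commute with differentiation, so the mean value theorem can be applied
    one order at a time. *)
Lemma central_difference_MVT k (g : nat -> R -> R) (h x : R) j : 0 < h ->
  (forall k, has_derivative (g k) (g k.+1)) ->
  exists2 x', `|x' - x| <= h *+ k & iter k (central_difference h) (g j) x = g (j + k)%N x'.
Proof.
move=> h0; elim: k g x => [|k IH] g x dg.
  by exists x; rewrite ?subrr ?normr0 ?addn0.
have dg' i : has_derivative (central_difference h (g i)) (central_difference h (g i.+1)).
  have d := has_derivativeM (has_derivativeB (has_derivative_shift h (dg i))
     (has_derivative_shift (- h) (dg i))) (has_derivative_cst (2 * h)^-1).
  by apply: has_derivative_ext d => s //=; rewrite mulr0 add0r mulrC.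
rewrite iterSr.
have [x' xx' ->] := IH (fun i => central_difference h (g i)) x dg'.
have le : x' - h <= x' + h by lra.
have [c /andP[c1 c2] E] := has_derivative_MVT le (dg (j + k)%N).
exists c.
  rewrite -(subrKA x') mulrSr [leRHS]addrC (le_trans (ler_normD _ _))// lerD//.
  by rewrite ler_norml; apply/andP; split; lra.
rewrite /central_difference E addnS.
have -> : x' + h - (x' - h) = 2 * h by ring.
by rewrite mulfK// mulf_neq0 ?pnatr_eq0// lt0r_neq0.
Qed.

End ComplexDerivative.

(** * Majorants and Taylor series *)

Section Majorants.
Context {R : realType}.
Implicit Types (p q : {poly R[i]}) (z w : R[i]).

Definition cabs z : R := Re `|z|.

Lemma cabsE z : `|z| = (cabs z)%:C.
Proof. by rewrite /cabs normc_def. Qed.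

Lemma ler_cabs z (r : R) : (cabs z <= r) = (`|z| <= r%:C).
Proof. by rewrite cabsE lecR. Qed.

Lemma cabs_ge0 z : 0 <= cabs z.
Proof. by have := normr_ge0 z; rewrite lecE => /andP[_]. Qed.

Lemma cabsM z w : cabs (z * w) = cabs z * cabs w.
Proof. by rewrite {1}/cabs normrM !cabsE ReM /= mulr0 subr0. Qed.

Lemma cabsX z k : cabs (z ^+ k) = cabs z ^+ k.
Proof.
elim: k => [|k IH]; first by rewrite !expr0 /cabs normr1.
by rewrite !exprS cabsM IH.
Qed.

Lemma cabsD z w : cabs (z + w) <= cabs z + cabs w.
Proof. by rewrite ler_cabs rmorphD /= -!cabsE ler_normD. Qed.

Lemma cabs_real (r : R) : 0 <= r -> cabs r%:C = r.
Proof. by move=> r0; rewrite /cabs ger0_norm// lecR. Qed.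

Lemma Re_le_cabs z : `|Re z| <= cabs z.
Proof. by rewrite -lecR -cabsE; exact: normc_ge_Re. Qed.

Lemma cabs_cexp z : cabs (cexp z) = expR (Re z).
Proof.
rewrite /cabs normc_def cexpE /= !exprMn -mulrDr cos2Dsin2 mulr1.
by rewrite sqrtr_sqr gtr0_norm// expR_gt0.
Qed.

Lemma ge0_real z : 0 <= z -> z = (Re z)%:C /\ 0 <= Re z.
Proof.
by case: z => a b; rewrite lecE /= => /andP[/eqP -> a0].
Qed.

(** Coefficientwise domination.  Being stable under sums, products and derivatives, it
    passes to [exp_deriv]. *)
Definition majorizes q p := forall i, `|p`_i| <= q`_i.

Lemma majorizes_ge0 q p i : majorizes q p -> 0 <= q`_i.
Proof. by move=> /(_ i); exact: le_trans. Qed.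

Lemma majorizesD q q' p p' : majorizes q p -> majorizes q' p' ->
  majorizes (q + q') (p + p').
Proof.
by move=> h h' i; rewrite !coefD (le_trans (ler_normD _ _))// lerD.
Qed.

Lemma majorizesM q q' p p' : majorizes q p -> majorizes q' p' ->
  majorizes (q * q') (p * p').
Proof.
move=> h h' i; rewrite !coefM (le_trans (ler_norm_sum _ _ _))// ler_sum// => j _.
by rewrite normrM ler_pM.
Qed.

Lemma majorizes_deriv q p : majorizes q p -> majorizes q^`() p^`().
Proof. by move=> h i; rewrite !coef_deriv normrMn lerMn2r h orbT. Qed.

Lemma majorizes_exp_deriv q p k : majorizes q p ->
  majorizes (exp_deriv q k) (exp_deriv p k).
Proof.
move=> h; elim: k => [i|k IH] /=.
  by rewrite !coefC; case: eqP => _; rewrite ?normr1 ?normr0.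
by apply: majorizesD; [|apply: majorizesM]; rewrite //; exact: majorizes_deriv.
Qed.

Lemma majorizes_horner q p z (r : R) : majorizes q p -> cabs z <= r ->
  `|p.[z]| <= q.[r%:C].
Proof.
move=> h zr.
rewrite (horner_coef_wide _ (leq_maxl (size p) (size q))).
rewrite (horner_coef_wide _ (leq_maxr (size p) (size q))).
rewrite (le_trans (ler_norm_sum _ _ _))// ler_sum// => i _.
by rewrite normrM ler_pM// normrX lerXn2r ?nnegrE// -?ler_cabs// lecR (le_trans (cabs_ge0 z)).
Qed.

Lemma exists_majorant p : exists q, majorizes q p.
Proof.
exists (\poly_(i < size p) `|p`_i|) => i; rewrite coef_poly.
by case: ltnP => // pi; rewrite nth_default ?normr0.
Qed.

(** For a majorant q with nonnegative coefficients, all derivatives of exp o q are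
    nonnegative on the positive half-line, so that a single Taylor term
    b^k / k! (exp o q)^(k)(r) is at most exp (q (r + b)). *)
Lemma exp_deriv_bound p (r b : R) : 0 <= r -> 0 < b ->
  exists2 C : R, 0 <= C & forall k z, cabs z <= r ->
    cabs (exp_deriv p k).[z] <= C * k`!%:R / b ^+ k.
Proof.
move=> r0 b0; have [q qp] := exists_majorant p.
have qq : majorizes q q.
  by move=> i; rewrite ger0_norm//; exact: majorizes_ge0 qp.
pose A := line_deriv q 1 r%:C 1.
have pt s : r%:C + 1 * s%:C = (r + s)%:C by rewrite mul1r rmorphD.
have val k (s : R) : 0 <= s -> exists a v : R, [/\ 0 <= a, 0 <= v,
    (exp_deriv q k).[(r + s)%:C] = a%:C & A k s = a * expR v].
  move=> s0; have rs0 : 0 <= r + s by rewrite addr_ge0.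
  have le : cabs (r + s)%:C <= r + s by rewrite cabs_real.
  have qk : 0 <= (exp_deriv q k).[(r + s)%:C].
    exact: le_trans (normr_ge0 _) (majorizes_horner (majorizes_exp_deriv k qq) le).
  have q0 : 0 <= q.[(r + s)%:C].
    exact: le_trans (normr_ge0 _) (majorizes_horner qq le).
  have [E1 a0] := ge0_real qk; have [E2 v0] := ge0_real q0.
  exists (Re (exp_deriv q k).[(r + s)%:C]), (Re q.[(r + s)%:C]); split=> //.
  rewrite /A /line_deriv pt expr1n !mul1r E1 E2 ReM cexpE /= cos0 sin0.
  by rewrite mulr1 mul0r subr0.
have A0 k s : 0 <= s -> 0 <= A k s.
  by move=> s0; have [a [v [a0 _ _ ->]]] := val k s s0; rewrite mulr_ge0// expR_ge0.
exists (A 0%N b) => [|k z zr]; first by rewrite A0// ltW.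
have [x /andP[x0 xb] E] := taylor k (ltW b0) (has_derivative_line q 1 r%:C 1).
have [a [v [a0 v0 aE AE]]] := val k 0 (lexx 0).
have az : cabs (exp_deriv p k).[z] <= a.
  rewrite ler_cabs -aE addr0; apply: majorizes_horner => //.
  exact: majorizes_exp_deriv.
have aA : a <= A k 0.
  by rewrite AE ler_peMr// -expR0 ler_expR.
rewrite (le_trans az)// (le_trans aA)//.
have f0 : 0 < k`!%:R :> R by rewrite ltr0n fact_gt0.
rewrite ler_pdivlMr ?exprn_gt0// -ler_pdivrMr//.
rewrite [X in X <= _](_ : _ = b ^+ k / k`!%:R * A k 0); last by ring.
rewrite [leRHS]E big_ord_recr /= -addrA [leRHS]addrC -addrA lerDl.
rewrite addr_ge0//.
  rewrite !mulr_ge0 ?(ltW b0) ?invr_ge0 ?ler0n//; last exact: A0.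
  by rewrite exprn_ge0// subr_ge0.
by apply: sumr_ge0 => i _; rewrite mulr_ge0 ?A0// divr_ge0// exprn_ge0// ltW.
Qed.

(** The bounds on the derivatives beat the factorials, so exp o p is the sum of its
    Taylor series along any complex direction. *)
Lemma line_taylor p c a w : exists C : R, forall N,
  `|line_deriv p c a w 0 1 - \sum_(k < N.+1) k`!%:R^-1 * line_deriv p c a w k 0|
    <= C / N.+1%:R.
Proof.
(* The rate b exceeds 4 |w|, so that the remainder is O(N.+1 / 4 ^ N.+1), which the
   inequality N.+1 <= 2 ^ N.+1 turns into O(1 / N.+1). *)
pose r := cabs a + cabs w; pose b := 4 * cabs w + 1.
have r0 : 0 <= r by rewrite addr_ge0 ?cabs_ge0.
have b0 : 0 < b by rewrite ltr_wpDl// mulr_ge0 ?cabs_ge0.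
have [C C0 CP] := exp_deriv_bound p r0 b0.
have [q qp] := exists_majorant p.
pose M := expR (Re q.[r%:C]).
have inside (s : R) : 0 <= s <= 1 -> cabs (a + w * s%:C) <= r.
  move=> /andP[s0 s1]; rewrite (le_trans (cabsD _ _))// lerD2l cabsM cabs_real//.
  by rewrite ler_piMr ?cabs_ge0.
have expM z : cabs z <= r -> cabs (cexp p.[z]) <= M.
  move=> zr; rewrite cabs_cexp ler_expR.
  have := majorizes_horner qp zr; rewrite cabsE => le.
  have [E q0] := ge0_real (le_trans (normr_ge0 _) (majorizes_horner qp zr)).
  rewrite E lecR in le.
  by rewrite (le_trans _ le)// (le_trans (ler_norm _)) ?Re_le_cabs.
have bound k s : 0 <= s <= 1 ->
    `|line_deriv p c a w k s| <= cabs c * C * M * (k`!%:R / 4 ^+ k).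
  move=> s01; rewrite (le_trans (Re_le_cabs _))// cabsM (cabsM (w ^+ k)).
  rewrite (cabsM (exp_deriv p k).[_]) cabsX.
  have h1 := CP k _ (inside _ s01); have h2 := expM _ (inside _ s01).
  rewrite -!mulrA ler_wpM2l ?cabs_ge0//.
  apply: (@le_trans _ _ (cabs w ^+ k * ((C * k`!%:R / b ^+ k) * M))).
    rewrite ler_wpM2l ?exprn_ge0 ?cabs_ge0// ler_pM ?cabs_ge0//.
  have -> : cabs w ^+ k * (C * k`!%:R / b ^+ k * M) =
      C * M * k`!%:R * (cabs w / b) ^+ k by rewrite expr_div_n; ring.
  have -> : C * (M * (k`!%:R / 4 ^+ k)) = C * M * k`!%:R * (4^-1) ^+ k by rewrite exprVn; ring.
  rewrite ler_wpM2l ?mulr_ge0 ?expR_ge0// lerXn2r ?nnegrE ?divr_ge0 ?cabs_ge0 ?(ltW b0)//.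
  rewrite ler_pdivrMr// ler_pdivlMl// /b; have := cabs_ge0 w; lra.
exists (cabs c * C * M) => N.
have [x /andP[x0 x1]] := taylor N (@ler01 R) (has_derivative_line p c a w).
under eq_bigr do rewrite expr1n mul1r.
set S := \sum_(k < _) _ => ->; rewrite addrAC subrr add0r mul1r normrM.
have D0 : 0 <= cabs c * C * M by rewrite !mulr_ge0 ?cabs_ge0 ?expR_ge0.
have f0 : 0 < N`!%:R :> R by rewrite ltr0n fact_gt0.
have h1 : `|(1 - x) ^+ N / N`!%:R| <= N`!%:R^-1.
  rewrite normrM [X in _ * X]ger0_norm ?invr_ge0 ?ler0n// ler_piMl ?invr_ge0 ?ler0n//.
  by rewrite normrX exprn_ile1// ger0_norm ?subr_ge0// lerBlDr lerDl.
have x01 : 0 <= x <= 1 by rewrite x0 x1.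
rewrite (le_trans (ler_pM (normr_ge0 _) (normr_ge0 _) h1 (bound N.+1 x x01)))//.
rewrite mulrCA ler_wpM2l// factS natrM.
have -> : N`!%:R^-1 * (N.+1%:R * N`!%:R / 4 ^+ N.+1) = N.+1%:R / 4 ^+ N.+1 :> R.
  by rewrite [LHS]mulrA (mulrCA _^-1) mulVf ?mulr1// lt0r_neq0.
rewrite ler_pdivrMr ?exprn_gt0// ler_pdivlMl ?ltr0n//.
rewrite -!natrM -natrX ler_nat.
have h := ltnW (ltn_expl N.+1 (isT : (1 < 2)%N)).
rewrite (_ : (4 ^ N.+1 = 2 ^ N.+1 * 2 ^ N.+1)%N) ?leq_mul//.
by rewrite -expnMn.
Qed.

End Majorants.

(** * The ridge inequality *)

Lemma cvg_sum_ord (R : realType) m (f : nat -> nat -> R) (l : nat -> R) :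
  (forall k, f k @ \oo --> l k) ->
  (fun n => \sum_(k < m) f k n) @ \oo --> \sum_(k < m) l k.
Proof.
move=> fl; elim: m => [|m IH].
  by rewrite big_ord0; under eq_fun do rewrite big_ord0; exact: cvg_cst.
by rewrite big_ord_recr; under eq_fun do rewrite big_ord_recr; exact: cvgD.
Qed.

Section RidgeProperty.
Context {R : realType} {d : measure_display} {Omega : measurableType d}.
Variable P : probability Omega R.

Definition mean_value (f : Omega -> R) : R := fine 'E_P[f].

Definition bounded_measurable (f : Omega -> R) : Prop :=
  measurable_fun [set: Omega] f /\ exists M, forall w, `|f w| <= M.

Lemma bounded_measurable_integrable f :
  bounded_measurable f -> P.-integrable setT (EFin \o f).
Proof.
move=> [mf [M fM]]; apply: measurable_bounded_integrable => //.
  by rewrite ltey_eq fin_num_measure.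
exists M; split; first exact: num_real.
by move=> r Mr w _ /=; rewrite (le_trans (fM w))// ltW.
Qed.

Lemma mean_valueE f : mean_value f = (\int[P]_w f w)%R.
Proof. by rewrite /mean_value /Rintegral unlock. Qed.

Lemma mean_valueD f g : bounded_measurable f -> bounded_measurable g ->
  mean_value (fun w => f w + g w) = mean_value f + mean_value g.
Proof.
move=> bf bg; rewrite !mean_valueE RintegralD//; exact: bounded_measurable_integrable.
Qed.

Lemma mean_valueZ a f : bounded_measurable f ->
  mean_value (fun w => a * f w) = a * mean_value f.
Proof.
move=> bf; rewrite !mean_valueE RintegralZl//; exact: bounded_measurable_integrable.
Qed.

Lemma mean_value_ge0 f : (forall w, 0 <= f w) -> 0 <= mean_value f.
Proof. by move=> f0; rewrite mean_valueE; apply: Rintegral_ge0. Qed.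

Lemma bounded_measurable_cst a : bounded_measurable (fun=> a).
Proof. by split; [exact: measurable_cst|exists `|a|]. Qed.

Lemma bounded_measurableD f g : bounded_measurable f -> bounded_measurable g ->
  bounded_measurable (fun w => f w + g w).
Proof.
move=> [mf [M fM]] [mg [N gN]]; split; first exact: measurable_funD.
by exists (M + N) => w; rewrite (le_trans (ler_normD _ _))// lerD.
Qed.

Lemma bounded_measurableM f g : bounded_measurable f -> bounded_measurable g ->
  bounded_measurable (fun w => f w * g w).
Proof.
move=> [mf [M fM]] [mg [N gN]]; split; first exact: measurable_funM.
by exists (M * N) => w; rewrite normrM ler_pM.
Qed.

Lemma bounded_measurableZ a f : bounded_measurable f ->
  bounded_measurable (fun w => a * f w).
Proof. exact: bounded_measurableM (bounded_measurable_cst a). Qed.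

Lemma bounded_measurableX f k : bounded_measurable f ->
  bounded_measurable (fun w => f w ^+ k).
Proof.
move=> bf; elim: k => [|k IH].
  by under eq_fun do rewrite expr0; exact: bounded_measurable_cst.
by under eq_fun do rewrite exprS; exact: bounded_measurableM.
Qed.

Lemma bounded_measurable_sum n (F : nat -> Omega -> R) :
  (forall k, bounded_measurable (F k)) ->
  bounded_measurable (fun w => \sum_(k < n) F k w).
Proof.
move=> bF; elim: n => [|n IH].
  by under eq_fun do rewrite big_ord0; exact: bounded_measurable_cst.
by under eq_fun do rewrite big_ord_recr; exact: bounded_measurableD.
Qed.

Lemma mean_value_sum n (F : nat -> Omega -> R) :
  (forall k, bounded_measurable (F k)) ->
  mean_value (fun w => \sum_(k < n) F k w) = \sum_(k < n) mean_value (F k).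
Proof.
move=> bF; elim: n => [|n IH].
  rewrite big_ord0; under [in LHS]eq_fun do rewrite big_ord0 -(mul0r 0).
  by rewrite mean_valueZ ?mul0r//; exact: bounded_measurable_cst.
rewrite big_ord_recr /= -IH -mean_valueD//; last exact: bounded_measurable_sum.
by under [in LHS]eq_fun do rewrite big_ord_recr.
Qed.

Lemma bounded_measurable_cos f : measurable_fun [set: Omega] f ->
  bounded_measurable (fun w => cos (f w)).
Proof.
move=> mf; split; last by exists 1 => w; exact: cos_max.
apply: (measurableT_comp (f := @cos R)) => //.
by apply: continuous_measurable_fun; exact: continuous_cos.
Qed.

Lemma bounded_measurable_sin f : measurable_fun [set: Omega] f ->
  bounded_measurable (fun w => sin (f w)).
Proof.
move=> mf; split; last by exists 1 => w; exact: sin_max.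
apply: (measurableT_comp (f := @sin R)) => //.
by apply: continuous_measurable_fun; exact: continuous_sin.
Qed.

Lemma cexpectation_cexp (f : Omega -> R) : measurable_fun [set: Omega] f ->
  cexpectation P (fun w => cexp (0 +i* f w)) =
  mean_value (fun w => cos (f w)) +i* mean_value (fun w => sin (f w)).
Proof.
move=> mf; rewrite /cexpectation /mean_value; congr (_ +i* _).
  by congr (fine 'E_P[_]); apply/funext => w; rewrite cexpE /= expR0 mul1r.
by congr (fine 'E_P[_]); apply/funext => w; rewrite cexpE /= expR0 mul1r.
Qed.

Variables (eta : Omega -> R) (p : {poly R[i]}).
Hypothesis meta : measurable_fun [set: Omega] eta.
Hypothesis char_eta : forall t,
  cexpectation P (fun w => cexp (0 +i* (t * eta w))) = cexp p.[t%:C].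

Let rot (th : R) : R[i] := cexp (0 +i* th).

Let sine_moment (h : R) (k : nat) (th x : R) : R :=
  mean_value (fun w => (sin (h * eta w) / h) ^+ k * cos (x * eta w + th)).

Let meas_scale (a : R) : measurable_fun [set: Omega] (fun w => a * eta w).
Proof. exact: measurable_funM. Qed.

Let meas_affine (a b : R) : measurable_fun [set: Omega] (fun w => a * eta w + b).
Proof. by apply: measurable_funD; [exact: meas_scale|exact: measurable_cst]. Qed.

Let bm_sine (h : R) : bounded_measurable (fun w => sin (h * eta w) / h).
Proof.
apply: bounded_measurableM; last exact: bounded_measurable_cst.
exact: bounded_measurable_sin.
Qed.

Let bm_moment (h : R) k th x :
  bounded_measurable (fun w => (sin (h * eta w) / h) ^+ k * cos (x * eta w + th)).
Proof.
apply: bounded_measurableM.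
  by apply: bounded_measurableX; exact: bm_sine.
by apply: bounded_measurable_cos; exact: meas_affine.
Qed.

Let sine_moment0 h th : sine_moment h 0 th = line_deriv p (rot th) 0 1 0.
Proof.
apply/funext => x; rewrite /line_deriv expr0 !mul1r hornerC mul1r add0r -char_eta.
have bc := bounded_measurable_cos (meas_scale x).
have bs := bounded_measurable_sin (meas_scale x).
rewrite cexpectation_cexp// /rot ReM cexpE /= expR0 !mul1r -mulNr.
rewrite -(mean_valueZ _ bc) -(mean_valueZ _ bs).
rewrite -mean_valueD; [|exact: bounded_measurableZ|exact: bounded_measurableZ].
by congr mean_value; apply/funext => w; rewrite expr0 mul1r cosD; ring.
Qed.

(** The product formula sin B cos A = (cos (A + B - pi/2) - cos (A - B - pi/2)) / 2 turns
    the factor sin (h eta) / h into a central difference in the frequency x. *)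
Let sine_momentS h k th : h != 0 ->
  sine_moment h k.+1 th = central_difference h (sine_moment h k (th - pi / 2)).
Proof.
move=> h0; apply/funext => x; rewrite /central_difference /sine_moment.
pose f (z : R) w := (sin (h * eta w) / h) ^+ k * cos (z * eta w + (th - pi / 2)).
have bf z : bounded_measurable (f z) by exact: bm_moment.
rewrite -[RHS]/((mean_value (f (x + h)) - mean_value (f (x - h))) / (2 * h)).
have -> : (mean_value (f (x + h)) - mean_value (f (x - h))) / (2 * h) =
    mean_value (fun w => (2 * h)^-1 * (f (x + h) w + -1 * f (x - h) w)).
  have bN := bounded_measurableZ (-1) (bf (x - h)).
  rewrite mean_valueZ; last exact: bounded_measurableD.
  by rewrite mean_valueD// mean_valueZ// mulN1r mulrC.
rewrite /f; congr mean_value; apply/funext => w.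
set A := x * eta w + th; set B := h * eta w.
have cs (u : R) : cos (u - pi / 2) = sin u.
  by rewrite -[in RHS](subrK (pi / 2) u) sinDpihalf.
have -> : (x + h) * eta w + (th - pi / 2) = (A + B) - pi / 2 by rewrite /A /B; ring.
have -> : (x - h) * eta w + (th - pi / 2) = (A - B) - pi / 2 by rewrite /A /B; ring.
rewrite !cs sinD sinB exprS.
by field.
Qed.

Let sine_moment_iter h k th : h != 0 ->
  sine_moment h k th =
  iter k (central_difference h) (line_deriv p (rot (th - pi / 2 *+ k)) 0 1 0).
Proof.
move=> h0; elim: k th => [|k IH] th.
  by rewrite mulr0n subr0 sine_moment0.
rewrite sine_momentS// IH iterS; congr (central_difference h (iter k _ _)).
by rewrite [_ *+ k.+1]mulrS opprD addrA.
Qed.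

Let rot_quarter th k : rot (th - pi / 2 *+ k) = rot th * (0 -i* 1) ^+ k.
Proof.
elim: k => [|k IH]; first by rewrite mulr0n subr0 expr0 mulr1.
have -> : th - pi / 2 *+ k.+1 = (th - pi / 2 *+ k) - pi / 2 by rewrite [_ *+ k.+1]mulrSr opprD addrA.
rewrite exprSr mulrA -IH /rot.
have -> : 0 -i* 1 = cexp (0 +i* (- (pi / 2))) :> R[i].
  by rewrite cexpE /= expR0 cosN sinN cos_pihalf sin_pihalf !mul1r.
by rewrite -cexpD; congr cexp; apply: complex_ext; rewrite ?ReD ?ImD //= addr0.
Qed.

(** As h tends to 0, sin (h eta) / h tends to eta: these moments tend to what would be
    the mean value of eta^k cos (x eta + th), and the limit is a derivative of exp o p
    whether or not eta has moments. *)
Let sine_moment_cvg k th x :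
  (fun n => sine_moment n.+1%:R^-1 k th x) @ \oo -->
  line_deriv p (rot (th - pi / 2 *+ k)) 0 1 k x.
Proof.
set g := line_deriv p (rot (th - pi / 2 *+ k)) 0 1.
have dg : forall j, has_derivative (g j) (g j.+1) by move=> j; exact: has_derivative_line.
have /choice[x_ xP] n : exists x', `|x' - x| <= n.+1%:R^-1 *+ k /\
    sine_moment n.+1%:R^-1 k th x = g k x'.
  have n0 : 0 < n.+1%:R^-1 :> R by rewrite invr_gt0.
  have [x' xx' E] := central_difference_MVT k x 0 n0 dg.
  by exists x'; split=> //; rewrite sine_moment_iter ?lt0r_neq0.
under eq_fun do rewrite (xP _).2.
apply: continuous_cvg; first exact: has_derivative_continuous (dg k) x.
apply/cvgrPdist_lt => e e0.
have e' : 0 < e / k.+1%:R by rewrite divr_gt0.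
near=> n; rewrite distrC (le_lt_trans (xP n).1)//.
rewrite (@le_lt_trans _ _ (n.+1%:R^-1 * k.+1%:R))//.
  by rewrite -[_ *+ k]mulr_natr ler_wpM2l// ?invr_ge0// ler_nat.
rewrite -ltr_pdivlMr//; near: n; exact: near_infty_natSinv_lt (PosNum e').
Unshelve. all: by end_near. Qed.

(** The quarter turns in the phase are the powers of -i which appear when exp o p is
    expanded in the direction of the imaginary axis. *)
Let line_direction th x y k :
  line_deriv p (rot th) x%:C (0 -i* y) k 0 =
  y ^+ k * line_deriv p (rot (th - pi / 2 *+ k)) 0 1 k x.
Proof.
rewrite /line_deriv rot_quarter expr1n !mul1r mulr0 addr0 add0r.
have -> : (0 -i* y) ^+ k = (y ^+ k)%:C * (0 -i* 1) ^+ k :> R[i].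
  rewrite rmorphXn -exprMn; congr (_ ^+ k).
  by apply: complex_ext; rewrite ?ReM ?ImM /=; ring.
set z := _ * cexp _; set u := (0 -i* 1) ^+ k; set r := rot th.
have -> : r * ((y ^+ k)%:C * u * z) = (y ^+ k)%:C * (r * u * z) by ring.
by rewrite ReM /= mul0r subr0.
Qed.

(** Let E be the partial sum of order 2N of the exponential series.  The function
    E (y sin (h eta) / h) (1 - cos (x eta + th)) is nonnegative, hence so is its mean
    value; let h tend to 0. *)
Let partial_sum_le th x y N :
  \sum_(k < (N + N).+1) k`!%:R^-1 * line_deriv p (rot th) x%:C (0 -i* y) k 0 <=
  \sum_(k < (N + N).+1) k`!%:R^-1 * line_deriv p (rot 0) 0%:C (0 -i* y) k 0.
Proof.
rewrite -subr_ge0 -sumrB.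
pose D n := \sum_(k < (N + N).+1) (y ^+ k / k`!%:R) *
  (sine_moment n.+1%:R^-1 k 0 0 - sine_moment n.+1%:R^-1 k th x).
have Dcvg : D @ \oo --> \sum_(k < (N + N).+1)
    (k`!%:R^-1 * line_deriv p (rot 0) 0%:C (0 -i* y) k 0 -
     k`!%:R^-1 * line_deriv p (rot th) x%:C (0 -i* y) k 0).
  pose f k n := (y ^+ k / k`!%:R) *
    (sine_moment n.+1%:R^-1 k 0 0 - sine_moment n.+1%:R^-1 k th x).
  pose l k := k`!%:R^-1 * line_deriv p (rot 0) 0%:C (0 -i* y) k 0 -
     k`!%:R^-1 * line_deriv p (rot th) x%:C (0 -i* y) k 0.
  apply: (cvg_sum_ord (f := f) (l := l)) => k; rewrite /f /l.
  rewrite !line_direction.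
  rewrite [X in _ --> X](_ : _ = y ^+ k / k`!%:R *
    (line_deriv p (rot (0 - pi / 2 *+ k)) 0 1 k 0 -
     line_deriv p (rot (th - pi / 2 *+ k)) 0 1 k x)); last by ring.
  apply: cvgM; first exact: cvg_cst.
  by apply: cvgB; exact: sine_moment_cvg.
apply: (closed_cvg (fun z : R => 0 <= z) _ _ _ Dcvg); first exact: closed_ge.
near=> n; rewrite /D.
set h : R := n.+1%:R^-1.
pose F k w := (y ^+ k / k`!%:R) *
   ((sin (h * eta w) / h) ^+ k * cos (0 * eta w + 0) +
    (- 1) * ((sin (h * eta w) / h) ^+ k * cos (x * eta w + th))).
have bF k : bounded_measurable (F k).
  apply: bounded_measurableZ; apply: bounded_measurableD => //.
  exact: bounded_measurableZ.
rewrite [leRHS](_ : _ = \sum_(k < (N + N).+1) mean_value (F k)); last first.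
  apply: eq_bigr => k _; rewrite /F mean_valueZ; last first.
    by apply: bounded_measurableD => //; exact: bounded_measurableZ.
  rewrite mean_valueD//; last exact: bounded_measurableZ.
  by rewrite mean_valueZ// mulN1r.
rewrite -mean_value_sum//; apply: mean_value_ge0 => w.
have -> : \sum_(k < (N + N).+1) F k w =
    (1 - cos (x * eta w + th)) *
    \sum_(k < (N + N).+1) (y * (sin (h * eta w) / h)) ^+ k / k`!%:R.
  rewrite mulr_sumr; apply: eq_bigr => k _.
  rewrite /F mul0r addr0 cos0; move: (sin _ / h) (cos _) => s c.
  by rewrite exprMn; ring.
by rewrite mulr_ge0 ?exp_partial_sum_ge0// subr_ge0 cos_le1.
Unshelve. all: by end_near. Qed.

(** The limit N to infinity of the previous inequality bounds the real part of
    exp (i th) exp (p (x + i y)) for every phase th; the phase is then chosen so that this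
    number is its own modulus. *)
Theorem ridge x y : Re p.[x +i* y] <= Re p.[0 +i* y].
Proof.
pose L th z := line_deriv p (rot th) z%:C (0 -i* (- y)) 0 1.
have LE th z : L th z = Re (rot th * cexp p.[z +i* y]).
  rewrite /L /line_deriv expr0 hornerC !mul1r; congr (Re (_ * cexp p.[_])).
  by apply: complex_ext => /=; ring.
have main th : L th x <= L 0 0.
  have [C1 h1] := line_taylor p (rot th) x%:C (0 -i* (- y)).
  have [C2 h2] := line_taylor p (rot 0) 0%:C (0 -i* (- y)).
  rewrite leNgt; apply/negP => lt.
  have e0 : 0 < L th x - L 0 0 by rewrite subr_gt0.
  pose N := Num.truncn ((`|C1| + `|C2|) / (L th x - L 0 0)).
  have := partial_sum_le th x (- y) N.
  have := h1 (N + N)%N; have := h2 (N + N)%N; rewrite -/(L th x) -/(L 0 0).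
  set S1 := \sum_(k < _) _; set S2 := \sum_(k < _) _.
  rewrite !ler_norml => /andP[a2 _] /andP[_ a1] le.
  have gt : (`|C1| + `|C2|) / (N + N).+1%:R < L th x - L 0 0.
    have := truncnS_gt ((`|C1| + `|C2|) / (L th x - L 0 0)); rewrite -/N => tN.
    rewrite ltr_pdivrMr// mulrC -ltr_pdivrMr// (lt_le_trans tN)// ler_nat ltnS.
    exact: leq_addr.
  have n0 : 0 < (N + N).+1%:R^-1 :> R by rewrite invr_gt0.
  have := ler_norm C1; have := ler_norm C2.
  rewrite -(ler_pM2r n0) => c2; rewrite -(ler_pM2r n0) => c1.
  rewrite mulrDl in gt.
  move: le a1 a2 c1 c2 gt; move: (L th x) (L 0 0) S1 S2 (C1 / _) (C2 / _).
  by move: (`|C1| / _) (`|C2| / _) => u1 u2 l l0 s1 s2 v1 v2 *; lra.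
have := main (- Im p.[x +i* y]); rewrite !LE /rot -!cexpD !cexpE /=.
rewrite !ReD !ImD /= !add0r addNr cos0 mulr1 => le.
by rewrite -ler_expR (le_trans le)// ler_piMr ?expR_ge0// cos_le1.
Qed.

End RidgeProperty.

(** * The theorem of Marcinkiewicz *)

Section Marcinkiewicz.
Context {R : realType}.
Implicit Types (p : {poly R[i]}) (z w : R[i]).

Lemma lt_Im_cabs z : Re z != 0 -> `|Im z| < cabs z.
Proof.
move=> z0; rewrite /cabs normc_def /= -sqrtr_sqr ltr_sqrt ?ltrDr.
  by rewrite exprn_even_gt0.
by rewrite ltr_pwDl ?sqr_ge0// exprn_even_gt0.
Qed.

Lemma cexpX z n : cexp z ^+ n = cexp (z *+ n).
Proof.
elim: n => [|n IH]; first by rewrite expr0 mulr0n cexp0.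
by rewrite exprS IH mulrS cexpD.
Qed.

(** If one n-th root is purely imaginary, turning it by the angle 2 pi / n < pi moves
    it off the axis. *)
Lemma root_off_imaginary_axis (a : R[i]) n : a != 0 -> (3 <= n)%N ->
  exists z, z ^+ n = a /\ Re z != 0.
Proof.
move=> a0 n3; have n0 : (0 < n)%N by apply: leq_trans n3.
pose w := n.-root a.
have wn : w ^+ n = a by exact: rootCK.
have [w0|w0] := eqVneq (Re w) 0; last by exists w.
pose th : R := 2 * pi / n%:R.
exists (w * cexp (0 +i* th)); split.
  rewrite exprMn wn cexpX.
  have -> : (0 +i* th) *+ n = 0 +i* (pi *+ 2) :> R[i].
    have aux m : (0 +i* th) *+ m = 0 +i* (th *+ m) :> R[i].
      by elim: m => [//|m IH]; rewrite !mulrS IH; apply: complex_ext => /=; rewrite ?addr0.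
    rewrite aux -[th *+ n]mulr_natr /th divfK ?pnatr_eq0 -?lt0n//.
    by rewrite mulr_natl.
  by rewrite cexpE /= expR0 cos2pi sin2pi !mul1r mulr1.
have th0 : 0 < th < pi.
  rewrite /th divr_gt0 ?mulr_gt0 ?pi_gt0 ?ltr0n//=.
  by rewrite ltr_pdivrMr ?ltr0n// mulrC ltr_pM2l ?pi_gt0// ltr_nat.
rewrite ReM w0 mul0r sub0r oppr_eq0 cexpE /= expR0 mul1r mulf_neq0//; last first.
  by rewrite gt_eqF// sin_gt0_pi.
apply: contra a0 => /eqP w1.
by rewrite -wn (_ : w = 0) ?expr0n ?gtn_eqF//; apply: complex_ext.
Qed.

(** Suppose that n = deg p >= 3 and let z^n be the conjugate of the leading coefficient
    a, with Re z <> 0.  Along the ray r z, the inequality compares two polynomials in r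
    whose coefficients of r^n are |a|^2 and Re (a (i Im z)^n) < |a| |z|^n = |a|^2. *)
Lemma ridge_size p : (forall x y, Re p.[x +i* y] <= Re p.[0 +i* y]) ->
  (size p <= 3)%N.
Proof.
move=> ridge_p; rewrite leqNgt; apply/negP => p3.
pose n := (size p).-1.
have pn : size p = n.+1 by rewrite prednK// (ltn_trans _ p3).
have n3 : (3 <= n)%N by rewrite pn ltnS in p3.
have n0 : (0 < n)%N by apply: leq_trans n3.
pose a := p`_n.
have a0 : a != 0 by rewrite /a -lead_coefE lead_coef_eq0 -size_poly_eq0 pn.
have [z [zn z0]] := root_off_imaginary_axis (a := a^*) (n := n)
  (eq_ind_r (fun b => ~~ b) a0 (conjC_eq0 a)) n3.
pose y := Im z.
pose g := \poly_(i < n.+1) (Re (p`_i * z ^+ i) - Re (p`_i * (0 +i* y) ^+ i)).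
have horner_ray w r : Re p.[w * r%:C] = \sum_(i < n.+1) Re (p`_i * w ^+ i) * r ^+ i.
  rewrite horner_coef pn.
  elim: n.+1 => [|m IH]; first by rewrite !big_ord0.
  rewrite !big_ord_recr ReD IH /=; congr (_ + _).
  rewrite exprMn mulrA -rmorphXn ReM /= mulr0 subr0//.
have gE r : g.[r] <= 0.
  rewrite horner_poly; under eq_bigr do rewrite mulrBl.
  rewrite sumrB -!horner_ray subr_le0.
  have := ridge_p (Re z * r) (y * r).
  have -> : Re z * r +i* (y * r) = z * r%:C.
    by apply: complex_ext; rewrite ?ReM ?ImM /= mulr0 ?subr0 ?add0r.
  have -> // : 0 +i* (y * r) = (0 +i* y) * r%:C.
  by apply: complex_ext; rewrite ?ReM ?ImM /= ?mulr0 ?mul0r ?subr0 ?add0r.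
have gn : 0 < Re (p`_n * z ^+ n) - Re (p`_n * (0 +i* y) ^+ n).
  rewrite subr_gt0 (le_lt_trans (ler_norm _))// (le_lt_trans (Re_le_cabs _))//.
  have -> : Re (p`_n * z ^+ n) = cabs (p`_n * z ^+ n).
    by rewrite zn /cabs -normCK [in RHS]normrX normr_id.
  rewrite !cabsM !cabsX ltr_pM2l; last first.
    rewrite lt_neqAle cabs_ge0 andbT eq_sym.
    apply: contra a0 => /eqP c0; have := cabsE a.
    by rewrite c0 => /eqP; rewrite normr_eq0.
  rewrite ltrXn2r ?nnegrE ?cabs_ge0// -?lt0n//.
  rewrite [ltLHS](_ : _ = `|y|) ?lt_Im_cabs//.
  by rewrite /cabs normc_def /= expr0n /= add0r sqrtr_sqr.
have gs : size g = n.+1 by rewrite size_poly_eq// lt0r_neq0.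
have lg : 0 < lead_coef g by rewrite lead_coefE gs /= coef_poly ltnSn.
have [r0 hr] := polyrcf.poly_pinfty_gt_lc lg.
have := le_trans (hr r0 (lexx _)) (gE r0).
by rewrite leNgt lg.
Qed.

(** In degree 2 the inequality reads
    Re p1 x + Re p2 x^2 - 2 Im p2 x y <= 0 for all x and y, which forces Im p2 = 0,
    Re p1 = 0 and Re p2 <= 0. *)
Lemma ridge_quadratic p : (forall x y, Re p.[x +i* y] <= Re p.[0 +i* y]) ->
  exists mean sigma : R, 0 <= sigma /\ forall t : R,
    p.[t%:C] = p.[0] + ((- (sigma * t ^+ 2 / 2)) +i* (mean * t)).
Proof.
move=> ridge_p; have sp := ridge_size ridge_p.
have pE z : p.[z] = p`_0 + p`_1 * z + p`_2 * z ^+ 2.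
  by rewrite (horner_coef_wide _ sp) !big_ord_recr big_ord0 /= add0r expr0 mulr1 expr1.
have key x y : Re p`_1 * x + Re p`_2 * x ^+ 2 - 2 * Im p`_2 * x * y <= 0.
  have := ridge_p x y; rewrite !pE !expr2 !ReD !ReM !ImM /=; nra.
have I2 : Im p`_2 = 0.
  apply/eqP; apply: contraT => m0.
  have := key 1 ((Re p`_1 + Re p`_2 - 1) / (2 * Im p`_2)).
  have -> : 2 * Im p`_2 * 1 * ((Re p`_1 + Re p`_2 - 1) / (2 * Im p`_2)) =
    Re p`_1 + Re p`_2 - 1 by field.
  rewrite expr1n; lra.
have {}key x : Re p`_1 * x + Re p`_2 * x ^+ 2 <= 0.
  by have := key x 0; rewrite mulr0 subr0.
have R2 : Re p`_2 <= 0.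
  by have := key 1; have := key (-1); rewrite expr1n sqrrN expr1n; lra.
have R1 : Re p`_1 = 0.
  apply/eqP; apply: contraT => u0.
  have v0 : 0 < 1 - Re p`_2 by lra.
  have := key (Re p`_1 / (1 - Re p`_2)).
  have -> : Re p`_1 * (Re p`_1 / (1 - Re p`_2)) +
      Re p`_2 * (Re p`_1 / (1 - Re p`_2)) ^+ 2 =
      (Re p`_1 / (1 - Re p`_2)) ^+ 2 by field; exact: lt0r_neq0.
  by rewrite leNgt exprn_even_gt0//= mulf_neq0// invr_eq0 lt0r_neq0.
exists (Im p`_1), (- (2 * Re p`_2)); split; first by lra.
move=> t; rewrite !pE expr0n /= !mulr0 !addr0 -addrA; congr (_ + _).
apply: complex_ext.
  by rewrite !expr2 ReD !ReM !ImM /= R1 I2; field.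
by rewrite !expr2 ImD !ImM !ReM /= R1 I2; ring.
Qed.

Theorem marcinkiewicz (d : measure_display) (Omega : measurableType d)
    (P : probability Omega R) (eta : Omega -> R) p :
  measurable_fun [set: Omega] eta ->
  (forall t, cexpectation P (fun w : Omega => cexp (0 +i* (t * eta w))) = cexp p.[t%:C]) ->
  exists mean sigma : R, 0 <= sigma /\ forall t : R,
    cexpectation P (fun w : Omega => cexp (0 +i* (t * eta w))) =
    cexp ((- (sigma * t ^+ 2 / 2)) +i* (mean * t)).
Proof.
move=> meta charE.
have [mean [sigma [s0 pE]]] := ridge_quadratic (ridge meta charE).
exists mean, sigma; split=> // t; rewrite charE pE cexpD.
suff -> : cexp p.[0] = 1 by rewrite mul1r.
have m0 : measurable_fun [set: Omega] (fun w : Omega => 0 * eta w).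
  exact: measurable_funM.
have := charE 0; rewrite (cexpectation_cexp P m0) => <-.
have -> : mean_value P (fun w : Omega => cos (0 * eta w)) = 1.
  rewrite (_ : (fun w : Omega => _) = fun=> 1); last by apply/funext => w; rewrite mul0r cos0.
  rewrite mean_valueE Rintegral_cst// mul1r.
  by have /= -> := @probability_setT _ _ _ P.
rewrite (_ : (fun w : Omega => sin _) = fun=> 0); last by apply/funext => w; rewrite mul0r sin0.
by rewrite mean_valueE Rintegral_cst// mul0r.
Qed.

End Marcinkiewicz.

(** * Differences and weak* sequential limits *)

Section ContinuousConvergence.
Context {R : realType}.

Definition ccvg (z_ : nat -> R[i]) (z : R[i]) : Prop :=
  (fun n => Re (z_ n)) @ \oo --> Re z /\ (fun n => Im (z_ n)) @ \oo --> Im z.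

Lemma ccvgM y_ y z_ z : ccvg y_ y -> ccvg z_ z -> ccvg (fun n => y_ n * z_ n) (y * z).
Proof.
move=> [yr yi] [zr zi]; split.
  by under eq_fun do rewrite ReM; rewrite ReM; apply: cvgB; apply: cvgM.
by under eq_fun do rewrite ImM; rewrite ImM; apply: cvgD; apply: cvgM.
Qed.

Lemma ccvgV z_ z : z != 0 -> ccvg z_ z -> ccvg (fun n => (z_ n)^-1) z^-1.
Proof.
move=> z0 [zr zi].
have ReV (w : R[i]) : Re w^-1 = Re w / (Re w ^+ 2 + Im w ^+ 2) by case: w.
have ImV (w : R[i]) : Im w^-1 = - (Im w / (Re w ^+ 2 + Im w ^+ 2)).
  by case: w.
have n0 : Re z ^+ 2 + Im z ^+ 2 != 0.
  apply: contra z0; rewrite paddr_eq0 ?sqr_ge0// !sqrf_eq0 => /andP[/eqP r0 /eqP i0].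
  by apply/eqP; apply: complex_ext.
have cn : (fun n => (Re (z_ n) ^+ 2 + Im (z_ n) ^+ 2)^-1) @ \oo -->
    (Re z ^+ 2 + Im z ^+ 2)^-1.
  by apply: cvgV => //; apply: cvgD; rewrite !expr2; apply: cvgM.
split.
  by under eq_fun do rewrite ReV; rewrite ReV; apply: cvgM.
by under eq_fun do rewrite ImV; rewrite ImV; apply: cvgN; apply: cvgM.
Qed.

Lemma ccvg_cst_eq z_ z c : ccvg z_ z -> (forall n, z_ n = c) -> z = c.
Proof.
move=> + zc; rewrite (_ : z_ = fun=> c); last exact/funext.
move=> [zr zi]; apply: complex_ext.
  exact: (cvg_unique _ zr (cvg_cst _)).
exact: (cvg_unique _ zi (cvg_cst _)).
Qed.

Context {V : normedModType R}.

(** Continuous convergence with respect to weak* sequences: unlike pointwise convergence,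
    it is preserved by quotient differences whose step varies along the sequence. *)
Definition wstar_ctscvg (u_ : nat -> dual V -> R[i]) (u : dual V -> R[i]) : Prop :=
  forall y_ y, wstar_cvg y_ y -> ccvg (fun n => u_ n (y_ n)) (u y).

Lemma wstar_cvg_cst (f : dual V) : wstar_cvg (fun=> f) f.
Proof. by move=> x; exact: cvg_cst. Qed.

Lemma wstar_cvgD f_ f g_ (g : dual V) : wstar_cvg f_ f -> wstar_cvg g_ g ->
  wstar_cvg (fun n => f_ n + g_ n) (f + g).
Proof. by move=> cf cg x; apply: cvgD; [exact: cf|exact: cg]. Qed.

Lemma wstar_ctscvg_mdiff h_ h u_ u : wstar_cvg h_ h -> (forall y, u y != 0) ->
  wstar_ctscvg u_ u -> wstar_ctscvg (fun n => mdiff (h_ n) (u_ n)) (mdiff h u).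
Proof.
move=> ch u0 cu y_ y cy; apply: ccvgM; first by apply: cu; exact: wstar_cvgD.
by apply: ccvgV => //; exact: cu.
Qed.

Lemma iter_mdiff_neq0 (W : zmodType) k (h : W) (u : W -> R[i]) :
  (forall y, u y != 0) -> forall y, iter k (mdiff h) u y != 0.
Proof. by move=> u0; elim: k => //= k IH; exact: mdiff_neq0. Qed.

Lemma wstar_ctscvg_iter_mdiff k h_ h u_ u : wstar_cvg h_ h -> (forall y, u y != 0) ->
  wstar_ctscvg u_ u ->
  wstar_ctscvg (fun n => iter k (mdiff (h_ n)) (u_ n)) (iter k (mdiff h) u).
Proof.
move=> ch u0 cu; elim: k => [|k IH] //.
by apply: wstar_ctscvg_mdiff => //; exact: iter_mdiff_neq0.
Qed.

Fixpoint mdiffs (W : zmodType) (hs : seq W) (u : W -> R[i]) : W -> R[i] :=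
  if hs is h :: hs' then mdiffs hs' (mdiff h u) else u.

Lemma wstar_ctscvg_mdiffs hs u_ u : (forall y, u y != 0) ->
  wstar_ctscvg u_ u -> wstar_ctscvg (fun n => mdiffs hs (u_ n)) (mdiffs hs u).
Proof.
elim: hs u_ u => // h hs IH u_ u u0 cu; apply: IH; first exact: mdiff_neq0.
by apply: wstar_ctscvg_mdiff => //; exact: wstar_cvg_cst.
Qed.

Fixpoint steps_in (W : Type) (Gs : seq (set W)) (hs : seq W) : Prop :=
  match Gs, hs with
  | G :: Gs', h :: hs' => G h /\ steps_in Gs' hs'
  | [::], [::] => True
  | _, _ => False
  end.

End ContinuousConvergence.

Section TotalSteps.
Context {R : realType} {V : completeNormedModType R}.
Hypotheses (sepV : separable V) (qrV : quasireflexive V).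

(** The steps are freed one after the other: when the others are fixed, the steps for
    which the difference is trivial form a weak* sequentially closed set. *)
Lemma mdiffs_extend (Gs : seq (set (dual V))) (u : dual V -> R[i]) :
  (forall i, (i < size Gs)%N -> total_subspace (nth set0 Gs i)) ->
  (forall y, u y != 0) -> wstar_ctscvg (fun=> u) u ->
  (forall hs, steps_in Gs hs -> forall y, mdiffs hs u y = 1) ->
  forall hs, size hs = size Gs -> forall y, mdiffs hs u y = 1.
Proof.
elim: Gs u => [|G Gs IH] u Gtot u0 cu h1 hs shs y.
  by case: hs shs => // _; exact: (h1 [::]).
case: hs shs => // h hs [shs].
apply: (@total_subspace_wstar_dense _ _ G (fun h => mdiffs hs (mdiff h u) y = 1)) => //.
- exact: (Gtot 0%N).
- move=> g Gg /=.
  apply: (IH (mdiff g u)) => //.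
  + by move=> i iGs; exact: (Gtot i.+1).
  + exact: mdiff_neq0.
  + by apply: wstar_ctscvg_mdiff => //; exact: wstar_cvg_cst.
  + by move=> hs' Ghs' y'; exact: (h1 (g :: hs')).
- move=> f_ f hf cf.
  have c : wstar_ctscvg (fun n => mdiffs hs (mdiff (f_ n) u)) (mdiffs hs (mdiff f u)).
    apply: wstar_ctscvg_mdiffs; first exact: mdiff_neq0.
    exact: wstar_ctscvg_mdiff.
  exact: ccvg_cst_eq (c _ _ (@wstar_cvg_cst _ _ y)) hf.
Qed.

(** The base point is freed first, then the steps of the list, and last the repeated
    step h.  For h the good steps are not known to form a subspace, since the difference
    of order N is not additive in h. *)
Lemma mdiff_extend (Gs : seq (set (dual V))) (H Y : set (dual V)) N (u : dual V -> R[i]) :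
  (forall i, (i < size Gs)%N -> total_subspace (nth set0 Gs i)) ->
  total_subspace H -> total_subspace Y ->
  (forall y, u y != 0) -> wstar_ctscvg (fun=> u) u ->
  (forall hs h y, steps_in Gs hs -> H h -> Y y ->
     mdiffs hs (iter N (mdiff h) u) y = 1) ->
  forall f y, iter (size Gs + N) (mdiff f) u y = 1.
Proof.
move=> Gtot Htot Ytot u0 cu h1 f y.
have citer h_ h k : wstar_cvg h_ h ->
    wstar_ctscvg (fun n => iter k (mdiff (h_ n)) u) (iter k (mdiff h) u).
  by move=> ch; exact: wstar_ctscvg_iter_mdiff.
have cH h_ h hs : wstar_cvg h_ h ->
    wstar_ctscvg (fun n => mdiffs hs (iter N (mdiff (h_ n)) u)) (mdiffs hs (iter N (mdiff h) u)).
  by move=> ch; apply: wstar_ctscvg_mdiffs (citer _ _ _ ch); exact: iter_mdiff_neq0.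
have h2 hs h y' : steps_in Gs hs -> H h -> mdiffs hs (iter N (mdiff h) u) y' = 1.
  move=> Ghs Hh.
  apply: (total_subspace_wstar_dense (G := Y)
    (S := fun y' => mdiffs hs (iter N (mdiff h) u) y' = 1)) => // [z Yz|z_ z zS cz].
    exact: h1.
  exact: ccvg_cst_eq (cH _ _ hs (@wstar_cvg_cst _ _ h) _ _ cz) zS.
have h3 hs h y' : size hs = size Gs -> H h -> mdiffs hs (iter N (mdiff h) u) y' = 1.
  move=> shs Hh; apply: (mdiffs_extend Gtot) => //.
  - exact: iter_mdiff_neq0.
  - exact: citer _ _ _ (@wstar_cvg_cst _ _ h).
  - by move=> hs' Ghs' z; exact: h2.
have h4 hs h : size hs = size Gs -> mdiffs hs (iter N (mdiff h) u) y = 1.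
  move=> shs.
  apply: (total_subspace_wstar_dense (G := H)
    (S := fun h => mdiffs hs (iter N (mdiff h) u) y = 1)) => // [z Hz|z_ z zS cz].
    exact: h3.
  exact: ccvg_cst_eq (cH _ _ hs cz _ _ (@wstar_cvg_cst _ _ y)) zS.
have mdiffs_nseq k v : mdiffs (nseq k f) v = iter k (mdiff f) v.
  by elim: k v => // k IH v; rewrite iterSr -IH.
by rewrite iterD -mdiffs_nseq; apply: h4; rewrite size_nseq.
Qed.

End TotalSteps.

(** * Total subspaces of steps *)

Section JointAdjoint.
Context {R : realType} {X : completeNormedModType R} {m n : nat}.
Context (A : 'I_m -> 'I_n -> {linear X -> X}).
Hypothesis cA : forall p j, continuous (A p j).
Implicit Types (kappa : 'I_m -> dual X) (x : X).

Lemma adjoint_continuous_functional p j (f : dual X) :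
  continuous_functional (fun x => f (A p j x) : R^o).
Proof.
apply/asboolP; split; first by move=> a x y; rewrite !linearP.
move=> x; apply: continuous_comp; first exact: cA.
exact: dual_continuous.
Qed.

Definition adjoint p j (f : dual X) : dual X := Dual (adjoint_continuous_functional p j f).

Definition joint_adjoint j kappa : dual X := \sum_p adjoint p j (kappa p).

Lemma joint_adjointE j kappa x : joint_adjoint j kappa x = \sum_p kappa p (A p j x).
Proof.
rewrite /joint_adjoint; elim: (index_enum _) => [|p s IH]; first by rewrite !big_nil.
by rewrite !big_cons dualD IH.
Qed.

Lemma joint_adjoint_linear j a kappa kappa' :
  joint_adjoint j (a *: kappa + kappa') = a *: joint_adjoint j kappa + joint_adjoint j kappa'.
Proof.
apply: dual_ext => x; rewrite dualD dualZ !joint_adjointE mulr_sumr -big_split /=.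
by apply: eq_bigr => p _.
Qed.

Lemma joint_adjointD j kappa kappa' :
  joint_adjoint j (kappa + kappa') = joint_adjoint j kappa + joint_adjoint j kappa'.
Proof. by have := joint_adjoint_linear j 1 kappa kappa'; rewrite !scale1r. Qed.

Lemma image_subspace j (K : set ('I_m -> dual X)) :
  subspace K -> subspace (joint_adjoint j @` K).
Proof.
move=> [K0 KL]; split.
  by exists 0 => //; apply: dual_ext => x; rewrite joint_adjointE big1.
move=> a _ _ [k Kk <-] [k' Kk' <-]; exists (a *: k + k'); first exact: KL.
exact: joint_adjoint_linear.
Qed.

Hypothesis kerA : forall p j, A p j @^-1` [set 0] = [set 0].

Lemma kernel_eq0 p j x : A p j x = 0 -> x = 0.
Proof. by move=> Ax; have : (A p j @^-1` [set 0]) x by []; rewrite kerA. Qed.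

Definition coordinate_steps (p : 'I_m) : set ('I_m -> dual X) :=
  [set kappa | forall q, q != p -> kappa q = 0].

(** The image consists of the functionals f o A_pj, and A_pj is injective. *)
Lemma total_coordinate_steps p j : total_subspace (joint_adjoint j @` coordinate_steps p).
Proof.
split.
  apply: image_subspace; split=> [q _ //|a k k' Kk Kk' q qp].
  by rewrite -[LHS]/(a *: k q + k' q) Kk// Kk'// scaler0 addr0.
move=> x hx; apply: (@kernel_eq0 p j); apply: dual_separates => f.
pose k q : dual X := if q == p then f else 0.
have := hx (joint_adjoint j k); rewrite joint_adjointE (bigD1 p)//= big1.
  rewrite /k eqxx addr0; apply; exists k => // q qp.
  by rewrite /k (negPf qp).
by move=> q qp; rewrite /k (negPf qp) dual0.
Qed.

Definition annihilating_steps (j : 'I_n) : set ('I_m -> dual X) :=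
  [set kappa | joint_adjoint j kappa = 0].

Lemma ptws_cvg (s : nat -> 'I_m -> X) (v : 'I_m -> X) :
  (forall p, (fun k => s k p) @ \oo --> v p) -> {ptws, s @ \oo --> v}.
Proof.
move=> h; apply/cvg_sup => p B; rewrite nbhsE => -[U [[W oW WU] Uv] UB].
have : \forall k \near \oo, W (s k p).
  by apply: h; apply: open_nbhs_nbhs; split=> //; move: Uv; rewrite -WU.
by apply: filterS => k Wk; apply: UB; rewrite -WU; exact: Wk.
Qed.

Lemma closure_product (G : set {ptws 'I_m -> X}) (v : 'I_m -> X) :
  (forall e, 0 < e -> exists2 s, G s & \sum_p `|v p - s p| < e) -> closure G v.
Proof.
move=> h.
have /choice[s sP] k : exists s : 'I_m -> X, G s /\ \sum_p `|v p - s p| < k.+1%:R^-1.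
  by have [|s Gs lt] := h k.+1%:R^-1; [rewrite invr_gt0|exists s].
apply: (closed_cvg (closure G) _ _ _ (@ptws_cvg s v _)).
- exact: closed_closure.
- by apply: nearW => k; apply: subset_closure; exact: (sP k).1.
- move=> p; apply/cvgrPdist_lt => e e0; near=> k.
  apply: (@lt_trans _ _ k.+1%:R^-1).
    by rewrite (le_lt_trans _ (sP k).2)// (bigD1 p)//= lerDl sumr_ge0.
  by near: k; exact: near_infty_natSinv_lt (PosNum e0).
Unshelve. all: by end_near. Qed.

Hypothesis graphA : forall i j, i != j ->
  closure (operator_graph A i) `&` closure (operator_graph A j) = [set (fun=> 0)].

(** If x is annihilated, then (A_pi x)_p is in the closure of the j-th graph: otherwise
    a functional on the m-th power of X would vanish on that graph and be 1 at
    (A_pi x)_p, and its components would be a step kappa with a_j kappa = 0 and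
    a_i kappa x = 1.  As (A_pi x)_p is also in the i-th graph, it is 0. *)
Lemma total_annihilating_steps i j (p : 'I_m) : i != j ->
  total_subspace (joint_adjoint i @` annihilating_steps j).
Proof.
move=> ij; split.
  apply: image_subspace; split.
    by apply: dual_ext => x; rewrite joint_adjointE big1.
  move=> a k k' Kk Kk'; rewrite /annihilating_steps /= joint_adjoint_linear.
  by rewrite Kk Kk' scaler0 addr0.
move=> x hx; apply: (@kernel_eq0 p i).
pose v : 'I_m -> X := fun q => A q i x.
suff : closure (operator_graph A j) v.
  move=> cj; have : (closure (operator_graph A i) `&` closure (operator_graph A j)) v.
    by split=> //; apply: subset_closure; exists x.
  by rewrite graphA// => /(congr1 (fun f => f p)).
apply: closure_product.
apply: contrapT => /existsNP[e /not_implyP[e0 h]].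
pose N (u : 'I_m -> X) := \sum_q `|u q|.
have ND u u' : N (u + u') <= N u + N u'.
  by rewrite /N -big_split ler_sum// => q _; exact: ler_normD.
have NZ a u : N (a *: u) = `|a| * N u.
  by rewrite /N mulr_sumr; apply: eq_bigr => q _; rewrite -normrZ.
have [||||F [Flin FG Fv FN]] := @hahn_banach_separation _ _ N ND NZ
    (range (fun y q => A q j y)) v e.
- by exists 0 => //; apply/funext => q; rewrite linear0.
- move=> a _ _ [y _ <-] [y' _ <-]; exists (a *: y + y') => //.
  by apply/funext => q; rewrite linearP.
- exact: e0.
- by move=> s Gs; rewrite leNgt; apply/negP => lt; apply: h; exists s.
pose single q (y : X) : 'I_m -> X := fun r => if r == q then y else 0.
have slin q a y y' : single q (a *: y + y') = a *: single q y + single q y'.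
  apply/funext => r; rewrite -[RHS]/(a *: single q y r + single q y' r) /single.
  by case: eqP => // _; rewrite scaler0 addr0.
have /choice[kappa kE] q : exists f : dual X, forall y, f y = F (single q y).
  apply: (@dual_of_bounded _ _ (fun y => F (single q y)) e^-1).
    by move=> a y y' /=; rewrite slin Flin.
  move=> y; rewrite (le_trans (FN _))// ler_wpM2l ?invr_ge0 ?(ltW e0)//.
  rewrite /N (bigD1 q)//= big1 ?addr0 /single ?eqxx// => r rq.
  by rewrite (negPf rq) normr0.
have Fsum (s : seq 'I_m) u : F (\sum_(q <- s) u q) = \sum_(q <- s) F (u q).
  elim: s => [|q s IH]; last first.
    by rewrite !big_cons; have := Flin 1 (u q) (\sum_(j <- s) u j); rewrite !scale1r IH.
  by rewrite !big_nil; have := Flin (-1) 0 0; rewrite !scaleN1r !addNr.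
have FE u : F u = \sum_q kappa q (u q).
  under eq_bigr do rewrite kE.
  rewrite -Fsum; congr F; apply/funext => q.
  rewrite fct_sumE (bigD1 q)//= big1 /single ?eqxx ?addr0// => r rq.
  by rewrite eq_sym (negPf rq).
have kj : annihilating_steps j kappa.
  apply: dual_ext => y; rewrite joint_adjointE dual0 -[LHS](FE (fun q => A q j y)).
  by apply: FG; exists y.
have := hx _ (ex_intro2 _ _ kappa kj erefl).
by rewrite joint_adjointE -[LHS](FE v) Fv => /eqP; rewrite oner_eq0.
Qed.

End JointAdjoint.

(** * Characteristic functionals *)

Section CharacteristicFunctional.
Context {R : realType} {d : measure_display} {Omega : measurableType d}.
Context {P : probability Omega R} {X : normedModType R}.
Variable xi : {RV P >-> borel X}.

Lemma measurable_dual_comp (f : dual X) :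
  measurable_fun [set: Omega] (fun w => f (xi w)).
Proof.
have mf : measurable_fun [set: borel X] (f : borel X -> R).
  apply: (measurability _ (RGenOInfty.measurableE R)) => _ [_ [x ->] <-].
  rewrite setTI; apply: sub_sigma_algebra.
  have /continuousP := @dual_continuous _ _ f; apply.
  exact: interval_open.
exact: (measurableT_comp mf (measurable_funPT xi)).
Qed.

Lemma charfunctionalE (f : dual X) : charfunctional P xi f =
  mean_value P (fun w => cos (f (xi w))) +i* mean_value P (fun w => sin (f (xi w))).
Proof. exact: cexpectation_cexp (measurable_dual_comp f). Qed.

Lemma mean_value_cvg (g_ : nat -> Omega -> R) (g : Omega -> R) :
  (forall n, measurable_fun [set: Omega] (g_ n)) ->
  (forall n w, `|g_ n w| <= 1) -> (forall w, (fun n => g_ n w) @ \oo --> g w) ->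
  (fun n => mean_value P (g_ n)) @ \oo --> mean_value P g.
Proof.
move=> mg g1 cg.
have fin : (\int[P]_w (g w)%:E)%E \is a fin_num.
  apply: integrable_fin_num => //; apply: bounded_measurable_integrable; split.
    by apply: (measurable_fun_cvg (h := g_)) => // w _; exact: cg.
  exists 1 => w; apply: (closed_cvg (fun z : R => `|z| <= 1) _ _ _ (cg w)).
    by apply: (@closed_comp _ _ (fun z : R => `|z|) [set z | z <= 1]);
      [move=> z _; exact: norm_continuous|exact: closed_le].
  by apply: nearW => k; exact: g1.
rewrite /mean_value; apply: fine_cvg; rewrite unlock fineK//.
apply: (@dominated_cvg _ _ _ P setT measurableT (fun n w => (g_ n w)%:E) _ (fun=> 1%E)) => //.
- by move=> n; apply/measurable_EFinP.
- by move=> w _; apply: cvg_EFin; [exact: nearW|exact: cg].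
- by apply: (@bounded_measurable_integrable _ _ _ P (fun=> 1)); exact: bounded_measurable_cst.
- by move=> n w _; rewrite lee_fin.
Qed.

(** Dominated convergence: weak* convergence is pointwise convergence of
    f_ n (xi w) for each w. *)
Lemma charfunctional_wstar : wstar_ctscvg (fun=> charfunctional P xi) (charfunctional P xi).
Proof.
move=> f_ f cf; rewrite charfunctionalE.
have h (c : R -> R) : continuous c -> (forall x, `|c x| <= 1) ->
    (fun n => mean_value P (fun w => c (f_ n (xi w)))) @ \oo -->
    mean_value P (fun w => c (f (xi w))).
  move=> cc c1; apply: mean_value_cvg => // [n|w].
    apply: (measurableT_comp (f := c)); last exact: measurable_dual_comp.
    exact: continuous_measurable_fun.
  by apply: continuous_cvg; [exact: cc|exact: cf].
split; under eq_fun do rewrite charfunctionalE /=.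
  by apply: h; [exact: continuous_cos|exact: cos_max].
by apply: h; [exact: continuous_sin|exact: sin_max].
Qed.

Lemma charfunctional0 : charfunctional P xi 0 = 1.
Proof.
rewrite charfunctionalE.
rewrite (_ : (fun w => cos _) = fun=> 1); last by apply/funext => w; rewrite dual0 cos0.
rewrite (_ : (fun w => sin _) = fun=> 0); last by apply/funext => w; rewrite dual0 sin0.
rewrite !mean_valueE !Rintegral_cst// mul0r mul1r.
by have /= -> := @probability_setT _ _ _ P.
Qed.

End CharacteristicFunctional.

(** * The functional equation *)

Section QuotientDifferences.
Context {R : realType} {W W' : zmodType}.

Lemma mdiffs1 (hs : seq W) : mdiffs hs (fun=> 1 : R[i]) = fun=> 1.
Proof. by elim: hs => //= h hs IH; rewrite mdiff1. Qed.

Lemma mdiffsM (hs : seq W) (u v : W -> R[i]) :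
  mdiffs hs (fun t => u t * v t) = fun t => mdiffs hs u t * mdiffs hs v t.
Proof. by elim: hs u v => //= h hs IH u v; rewrite mdiffM IH. Qed.

Lemma iter_mdiff1 k (h : W) : iter k (mdiff h) (fun=> 1 : R[i]) = fun=> 1.
Proof. by elim: k => //= k ->; exact: mdiff1. Qed.

Lemma mdiff_iterC k (h g : W) (u : W -> R[i]) :
  mdiff g (iter k (mdiff h) u) = iter k (mdiff h) (mdiff g u).
Proof. by elim: k => //= k <-; rewrite mdiffC. Qed.

Lemma multiplicative_prod (D : (W -> R[i]) -> W -> R[i]) (I : Type) (r : seq I)
    (Q : pred I) (u : I -> W -> R[i]) :
  D (fun=> 1) = (fun=> 1) ->
  (forall v w, D (fun t => v t * w t) = fun t => D v t * D w t) ->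
  D (fun t => \prod_(i <- r | Q i) u i t) = fun t => \prod_(i <- r | Q i) D (u i) t.
Proof.
move=> D1 DM; elim: r => [|i r IH].
  rewrite (_ : (fun t => _) = fun=> 1); last by apply/funext => t; rewrite big_nil.
  by rewrite D1; apply/funext => t; rewrite big_nil.
have [Qi|Qi] := boolP (Q i).
  rewrite (_ : (fun t => _) = fun t => u i t * \prod_(i <- r | Q i) u i t).
    by rewrite DM IH; apply/funext => t; rewrite big_cons Qi.
  by apply/funext => t; rewrite big_cons Qi.
rewrite (_ : (fun t => _) = fun t => \prod_(i <- r | Q i) u i t).
  by rewrite IH; apply/funext => t; rewrite big_cons (negPf Qi).
by apply/funext => t; rewrite big_cons (negPf Qi).
Qed.

(** Differences commute, so a single step that leaves u unchanged is enough. *)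
Lemma mdiffs_annihilated (I : eqType) (K : I -> set W) (r : seq I) (c : I)
    (hs : seq W) (u : W -> R[i]) :
  c \in r -> (forall h, K c h -> mdiff h u = fun=> 1) ->
  steps_in (map K r) hs -> mdiffs hs u = fun=> 1.
Proof.
elim: r hs u => // a r IH [//|h hs] u; rewrite in_cons => /orP[/eqP <-|cr] kill /= [Kh Ks].
  by rewrite kill// mdiffs1.
by apply: IH => // g Kg; rewrite mdiffC kill// mdiff1.
Qed.

Lemma steps_in_image (I : Type) (K : I -> set W) (a : W -> W') (r : seq I) hs :
  steps_in (map (fun c => a @` K c) r) hs ->
  exists2 ks, steps_in (map K r) ks & hs = map a ks.
Proof.
elim: r hs => [[|//] _|c r IH [//|h hs] /= [[k Kk <-] /IH[ks Kks ->]]].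
  by exists [::].
by exists (k :: ks).
Qed.

Lemma mdiff_comp (a : W -> W') (k : W) (u : W' -> R[i]) :
  {morph a : x y / x + y} -> mdiff k (fun t => u (a t)) = fun t => mdiff (a k) u (a t).
Proof. by move=> aD; apply/funext => t; rewrite /mdiff aD. Qed.

Lemma iter_mdiff_comp (a : W -> W') n (k : W) (u : W' -> R[i]) :
  {morph a : x y / x + y} ->
  iter n (mdiff k) (fun t => u (a t)) = fun t => iter n (mdiff (a k)) u (a t).
Proof. by move=> aD; elim: n => //= n ->; rewrite mdiff_comp. Qed.

Lemma mdiffs_comp (a : W -> W') (ks : seq W) (u : W' -> R[i]) :
  {morph a : x y / x + y} ->
  mdiffs ks (fun t => u (a t)) = fun t => mdiffs (map a ks) u (a t).
Proof. by move=> aD; elim: ks u => //= k ks IH u; rewrite mdiff_comp. Qed.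

Lemma iter_fdiff_comp (a : W -> W') n (k : W) (q : W' -> R[i]) :
  {morph a : x y / x + y} ->
  iter n (forward_difference k) (fun t => q (a t)) =
  fun t => iter n (forward_difference (a k)) q (a t).
Proof.
move=> aD; elim: n => //= n ->; apply/funext => t.
by rewrite /forward_difference aD.
Qed.

Lemma mdiff_period (h : W) (u : W -> R[i]) : (forall t, u t != 0) ->
  (forall t, u (t + h) = u t) -> mdiff h u = fun=> 1.
Proof. by move=> u0 uh; apply/funext => t; rewrite /mdiff uh divff. Qed.

End QuotientDifferences.

Lemma nth_map_all (T : eqType) (S : Type) (x : S) (f : T -> S) (Q : S -> Prop) (r : seq T) :
  (forall c, c \in r -> Q (f c)) -> forall k, (k < size (map f r))%N -> Q (nth x (map f r) k).
Proof.
elim: r => //= c r IH Qf [|k] /=; first by move=> _; apply: Qf; rewrite mem_head.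
by apply: IH => e er; apply: Qf; rewrite in_cons er orbT.
Qed.

Lemma exists_missed_index (m k : nat) (s : k.-tuple 'I_m) : (k < m)%N ->
  exists p, p \notin s.
Proof.
move=> km; apply/existsP; apply: contraLR km; rewrite negb_exists => /forallP h.
rewrite -leqNgt -[leqRHS](size_tuple s) -[leqLHS]card_ord cardE.
by apply: uniq_leq_size; [exact: enum_uniq|move=> p _; have := h p; rewrite negbK].
Qed.

Section FunctionalEquation.
Context {R : realType} {X : completeNormedModType R} {d : measure_display}.
Context {Omega : measurableType d} {P : probability Omega R} {n m : nat}.
Context (A : 'I_m -> 'I_n -> {linear X -> X}) (xi : 'I_n -> {RV P >-> borel X}).
Hypothesis cA : forall p j, continuous (A p j).

Local Notation adj := (joint_adjoint cA).
Local Notation char j := (charfunctional P (xi j)).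

Lemma joint_charfunctional_forms (kappa : 'I_m -> dual X) :
  joint_charfunctional P (linear_forms A xi) kappa =
  joint_charfunctional P xi (fun j => adj j kappa).
Proof.
congr (cexpectation P _); apply/funext => w; congr (cexp (0 +i* _)).
under eq_bigr do rewrite /linear_forms linear_sum /=.
rewrite exchange_big /=; apply: eq_bigr => j _.
by rewrite joint_adjointE.
Qed.

(** Every factor of the functional equation but the i-th is unchanged by the steps of
    at least one of these indices. *)
Definition step_index (i : 'I_n) : seq ('I_m + 'I_n) :=
  [seq inl p | p <- enum 'I_m] ++ [seq inr j | j <- enum 'I_n & j != i].

Definition steps (c : 'I_m + 'I_n) : set ('I_m -> dual X) :=
  match c with
  | inl p => coordinate_steps p
  | inr j => annihilating_steps cA j
  end.

(** A product indexed by (m-1)-tuples has no factor that depends on all the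
    coordinates, so one step in each coordinate trivializes the right-hand side. *)
Lemma isolated_factor i : (2 <= m)%N ->
  Q_independent P xi -> (forall j (f : dual X), char j f != 0) ->
  in_class_D P m.-1 (linear_forms A xi) ->
  exists N, forall ks h f, steps_in (map steps (step_index i)) ks ->
    mdiffs (map (adj i) ks) (iter N.+1 (mdiff (adj i h)) (char i)) (adj i f) = 1.
Proof.
move=> m2 [q [[N qN] _ _ qE]] char0 [F [_ FE]].
exists N => ks h f Kks.
have adjD j : {morph adj j : x y / x + y} by move=> x y; exact: joint_adjointD.
pose a (kappa : 'I_m -> dual X) : 'I_n -> dual X := fun j => adj j kappa.
have aD : {morph a : x y / x + y} by move=> x y; apply/funext => j; exact: adjD.
pose U j kappa := char j (adj j kappa).
pose E kappa := cexp (q (a kappa)).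
pose T (s : (m.-1).-tuple 'I_m) (kappa : 'I_m -> dual X) := F s (fun j => kappa (tnth s j)).
have eqn : (fun kappa => (\prod_(j < n) U j kappa) * E kappa) =
    fun kappa => \prod_(s : (m.-1).-tuple 'I_m | increasing_tuple s) T s kappa.
  by apply/funext => kappa; rewrite -FE joint_charfunctional_forms qE.
(* The left-hand side has no zeros, hence neither has any of the F_s. *)
have T0 s kappa : increasing_tuple s -> T s kappa != 0.
  move=> inc; have := congr1 (fun f => f kappa) eqn => /= eqk.
  have : \prod_(s : (m.-1).-tuple 'I_m | increasing_tuple s) T s kappa != 0.
    by rewrite -eqk mulf_neq0 ?cexp_neq0//; apply/prodf_neq0 => j _; exact: char0.
  by move/prodf_neq0 => /(_ s inc).
pose D (u : ('I_m -> dual X) -> R[i]) := mdiffs ks (iter N.+1 (mdiff h) u).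
have D1 : D (fun=> 1) = fun=> 1 by rewrite /D iter_mdiff1 mdiffs1.
have DM v w : D (fun t => v t * w t) = fun t => D v t * D w t.
  by rewrite /D iter_mdiffM mdiffsM.
have kill c u : c \in step_index i -> (forall k, steps c k -> mdiff k u = fun=> 1) ->
    D u = fun=> 1.
  move=> ci ku; apply: (mdiffs_annihilated ci _ Kks) => k Kk.
  by rewrite mdiff_iterC ku// iter_mdiff1.
have DT s : increasing_tuple s -> D (T s) = fun=> 1.
  move=> inc; have [|p ps] := exists_missed_index s; first by rewrite prednK// ltnW.
  apply: (kill (inl p)); first by rewrite mem_cat map_f// mem_enum.
  move=> k Kk; apply: mdiff_period => [t|t]; first exact: T0.
  rewrite /T; congr (F s _); apply/funext => j.
  rewrite -[LHS]/(t (tnth s j) + k (tnth s j)) Kk ?addr0//.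
  by apply: contraNneq ps => <-; exact: mem_tnth.
have DU j : j != i -> D (U j) = fun=> 1.
  move=> ji; apply: (kill (inr j)).
    by rewrite mem_cat map_f ?orbT// mem_filter ji mem_enum.
  move=> k Kk; apply: mdiff_period => t; first exact: char0.
  by rewrite /U adjD Kk addr0.
have DE : D E = fun=> 1.
  rewrite /D /E iter_mdiff_cexp (_ : (fun t => _) = fun=> 1) ?mdiffs1//.
  by apply/funext => t; rewrite (iter_fdiff_comp _ _ _ aD) qN cexp0.
have := congr1 (fun u => D u f) eqn.
rewrite DM DE mulr1 (multiplicative_prod _ _ _ D1 DM) (multiplicative_prod _ _ _ D1 DM).
rewrite [RHS]big1; last by move=> s inc; rewrite DT.
rewrite (bigD1 i)//= big1 ?mulr1; last by move=> j ji; rewrite DU.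
by rewrite /D /U (iter_mdiff_comp _ _ _ (adjD i)) (mdiffs_comp _ _ (adjD i)).
Qed.

End FunctionalEquation.

Lemma charfunctional_ray (R : realType) (X : normedModType R) (d : measure_display)
    (Omega : measurableType d) (P : probability Omega R) (xi : {RV P >-> borel X})
    (f : dual X) (M : nat) :
  (forall h y, iter M.+1 (mdiff h) (charfunctional P xi) y = 1) ->
  exists p : {poly R[i]}, forall t : R, charfunctional P xi (t *: f) = cexp p.[t%:C].
Proof.
move=> uM; pose phi (t : R) := charfunctional P xi (t *: f).
have cphi (t_ : nat -> R) t : t_ @ \oo --> t -> ccvg (fun n => phi (t_ n)) (phi t).
  move=> tt; apply: charfunctional_wstar => x.
  by apply: cvgM; [exact: tt|exact: cvg_cst].
apply: (@polynomial_logarithm _ M phi).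
- by move=> t; apply/(@cvg_nbhsP _ R^o) => t_ tt; have [] := cphi _ _ tt.
- by move=> t; apply/(@cvg_nbhsP _ R^o) => t_ tt; have [] := cphi _ _ tt.
- by rewrite /phi scale0r charfunctional0.
- move=> h t; rewrite (@iter_mdiff_comp _ _ _ (fun s : R => s *: f)).
    exact: uM.
  by move=> x y; rewrite scalerDl.
Qed.

Theorem theorem2p3 (R : realType) (X : completeNormedModType R)
    (d : measure_display) (Omega : measurableType d) (P : probability Omega R)
    (n m : nat) (A : 'I_m -> 'I_n -> {linear X -> X})
    (xi : 'I_n -> {RV P >-> borel X}) :
  separable X -> quasireflexive X ->
  (1 <= n)%N -> (2 <= m)%N ->
  (forall p j, continuous (A p j)) ->
  (forall p j, A p j @^-1` [set 0] = [set 0]) ->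
  (forall i j, i != j ->
     closure (operator_graph A i) `&` closure (operator_graph A j) = [set (fun=> 0)]) ->
  Q_independent P xi ->
  (forall i (f : dual X), charfunctional P (xi i) f != 0) ->
  in_class_D P m.-1 (linear_forms A xi) ->
  forall i, gaussian P (xi i).
Proof.
move=> sepX qrX _ m2 cA kerA graphA Qind char0 classD i f.
pose p0 : 'I_m := Ordinal (ltnW m2).
have [N iso] := isolated_factor cA i m2 Qind char0 classD.
pose Gs := map (fun c => joint_adjoint cA i @` steps cA c) (step_index i).
pose H := joint_adjoint cA i @` coordinate_steps p0.
have Htot : total_subspace H by exact: total_coordinate_steps.
have Gtot k : (k < size Gs)%N -> total_subspace (nth set0 Gs k).
  apply: nth_map_all => -[p _|j]; first exact: total_coordinate_steps.
  rewrite mem_cat => /orP[/mapP[] //|/mapP[j' + [->]]].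
  rewrite mem_filter eq_sym => /andP[ij _].
  exact: total_annihilating_steps.
have uM h y : iter (size Gs + N.+1) (mdiff h) (charfunctional P (xi i)) y = 1.
  apply: (@mdiff_extend _ _ sepX qrX Gs H H N.+1 _ Gtot Htot Htot) => //.
  - exact: charfunctional_wstar.
  - move=> hs h' y' /steps_in_image[ks Kks ->] [kh _ <-] [ky _ <-].
    exact: iso.
rewrite addnS in uM.
have [p pE] := charfunctional_ray f uM.
apply: (marcinkiewicz (p := p)); first exact: measurable_dual_comp.
exact: pE.
Qed.
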